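(* Let $f: \mathbb{S}^3 \rightarrow \mathbb{C}$ be a $(\lambda,\mu)$-eigenfunction on the unit round sphere $\mathbb{S}^3\subset\mathbb{R}^4$ given by a polynomial $F:\mathbb{R}^4\to\mathbb{C}$, and suppose that $0\in f(\mathbb{S}^3)$ is a regular value of $f$. For $\alpha\in\mathbb{C}$ with $|\alpha|=1$ put $a:=\operatorname{Re}\alpha$, $b:=\operatorname{Im}\alpha$, let $l_\alpha=\{u+iv : u,v\in\mathbb{R},\ a u+b v=0\}\subset\mathbb{C}$, and let $P_\alpha := a\operatorname{Re}F+b\operatorname{Im}F:\mathbb{R}^4\to\mathbb{R}$. Then: (1) for all $\alpha,\beta\in\mathbb{C}$ with $|\alpha|=|\beta|=1$ there exists an isometry of $\mathbb{R}^4$ that induces an isometry between $f^{-1}(l_\alpha)$ and $f^{-1}(l_\beta)$; (2) the submanifold $f^{-1}(l_\alpha)$ is minimal in $\mathbb{S}^3$ for all $\alpha$ with $|\alpha|=1$ if and only if there is some $\alpha_0\in\mathbb{C}$ with $|\alpha_0|=1$ such that for all $x\in P_{\alpha_0}^{-1}(0)$ one has $$\operatorname{Hess}P_{\alpha_0}(x)\big(\operatorname{grad}P_{\alpha_0}(x),\operatorname{grad}P_{\alpha_0}(x)\big)=0.$$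
   Context: Let $(M,g)$ be a Riemannian manifold, and extend $g$ to a complex bilinear form on the complexified tangent bundle $T^{\mathbb{C}}M$. For smooth functions $\varphi,\psi: M\to\mathbb{C}$ define $\tau(\varphi) := \operatorname{div}\operatorname{grad}\varphi$ and $\varkappa(\varphi,\psi) := g(\operatorname{grad}\varphi,\operatorname{grad}\psi)$ (complex bilinear, not Hermitian). A function $f: M\to\mathbb{C}$ is a $(\lambda,\mu)$-eigenfunction if there exist $\lambda,\mu\in\mathbb{C}$ such that $\tau(f)=\lambda f$ and $\varkappa(f,f)=\mu f^2$. A $(\lambda,\mu)$-eigenfunction $f$ on $\mathbb{S}^3$ (with the canonical round metric) is said to be given by a polynomial $F$ if $F:\mathbb{R}^4\to\mathbb{C}$ is a homogeneous polynomial with complex coefficients that is a $(0,0)$-eigenfunction on Euclidean $\mathbb{R}^4$ (i.e. $\tau(F)=0$ and $\varkappa(F,F)=0$) and $f=F|_{\mathbb{S}^3}$. Regularity of the value $0$ is meant for $f$ as a smooth map $\mathbb{S}^3\to\mathbb{C}\cong\mathbb{R}^2$. The gradient and Hessian of $P_\alpha$ are the Euclidean ones on $\mathbb{R}^4$. Minimal means vanishing mean curvature. *)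

(* Defs.v *)
From HB Require Import structures.
From mathcomp Require Import all_boot all_order all_algebra.
From mathcomp Require Import all_classical all_reals all_analysis.
From mathcomp Require Import complex.
(* Notations not imported: they clash with those of MathComp-Analysis. *)
From mathcomp Require mpoly.
Import (canonicals, coercions) mpoly.

Set Implicit Arguments.
Unset Strict Implicit.
Unset Printing Implicit Defensive.

Import Order.TTheory GRing.Theory Num.Theory.
Import numFieldNormedType.Exports.
Local Open Scope classical_set_scope.
Local Open Scope ring_scope.
Local Open Scope complex_scope.

(* The library norm and distance on row vectors are those of the sup norm,
   which is used here only for its topology; lengths are taken with [enorm]. *)
Definition dot (K : nzRingType) (u v : 'rV[K]_4) : K :=
  \sum_(i < 4) u 0 i * v 0 i.

Definition enorm (R : realType) (u : 'rV[R]_4) : R := Num.sqrt (dot u u).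

Definition e_ (R : realType) (i : 'I_4) : 'rV[R]_4 := delta_mx 0 i.

Section Euclidean.
Variable R : realType.
Implicit Types (x v w : 'rV[R]_4) (h : 'rV[R]_4 -> R) (phi psi : 'rV[R]_4 -> R[i]).

Definition partial (i : 'I_4) h : 'rV[R]_4 -> R := fun x => 'D_(e_ R i) h x.

Definition grad h x : 'rV[R]_4 := \row_i partial i h x.

Definition Hess h x v w : R :=
  \sum_(i < 4) \sum_(j < 4) partial i (partial j h) x * v 0 i * w 0 j.

Fixpoint Ck_on (k : nat) (U : set ('rV[R]_4)) h : Prop :=
  if k is k'.+1 then
    (forall x, U x -> differentiable h x) /\
    (forall i, Ck_on k' U (partial i h))
  else forall x, U x -> {for x, continuous h}.

Definition smooth_on (U : set ('rV[R]_4)) h := forall k, Ck_on k U h.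

(* Differential operators on complex-valued functions and on sections of the
   complexified tangent bundle: the complex linear extensions of the real ones. *)

Definition re_part phi : 'rV[R]_4 -> R := fun x => complex.Re (phi x).
Definition im_part phi : 'rV[R]_4 -> R := fun x => complex.Im (phi x).

Definition csmooth_on (U : set ('rV[R]_4)) phi :=
  smooth_on U (re_part phi) /\ smooth_on U (im_part phi).

Definition cderiv phi x v : R[i] :=
  ('D_v (re_part phi) x) +i* ('D_v (im_part phi) x).

Definition cgrad phi x : 'rV[R[i]]_4 := \row_i cderiv phi x (e_ R i).

Definition cdiv (X : 'rV[R]_4 -> 'rV[R[i]]_4) x : R[i] :=
  \sum_(i < 4) cderiv (fun y => X y 0 i) x (e_ R i).

Definition tau phi : 'rV[R]_4 -> R[i] := cdiv (cgrad phi).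

Definition kappa phi psi x : R[i] := dot (cgrad phi x) (cgrad psi x).

Definition eigenfunction_E4 (lambda mu : R[i]) phi :=
  [/\ csmooth_on setT phi,
      forall x, tau phi x = lambda * phi x
    & forall x, kappa phi phi x = mu * phi x ^+ 2].

End Euclidean.

Definition S3 (R : realType) := {x : 'rV[R]_4 | dot x x == 1}.

Section Sphere.
Variable R : realType.
Implicit Types (p q : S3 R) (v w : 'rV[R]_4) (h : S3 R -> R) (f g : S3 R -> R[i]).

(* Extension constant along rays, [x |-> f (x / |x|)], with junk value [0] at
   the origin. Its radial derivative vanishes, so at a point [p] of the sphere
   - the Euclidean gradient of the extension of a function is tangent to the
     sphere and is the gradient of the function for the round metric;
   - the Euclidean divergence of the extension of a tangent field [X] is the
     trace over the tangent space of [v |-> D_v X]; only the tangential part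
     of [D_v X], i.e. the Levi-Civita derivative, contributes to that trace,
     so this is the divergence of [X] on the sphere. *)
Definition ray_ext (V : zmodType) (f : S3 R -> V) : 'rV[R]_4 -> V :=
  fun x => oapp f 0 (insub ((enorm x)^-1 *: x) : option (S3 R)).

Definition tangent p v := dot v (val p) = 0.

Definition sgrad h p : 'rV[R]_4 := grad (ray_ext h) (val p).

Definition scgrad f p : 'rV[R[i]]_4 := cgrad (ray_ext f) (val p).

Definition scdiv (X : S3 R -> 'rV[R[i]]_4) p : R[i] :=
  cdiv (ray_ext X) (val p).

Definition stau f : S3 R -> R[i] := scdiv (scgrad f).

Definition skappa f g p : R[i] := dot (scgrad f p) (scgrad g p).

Definition eigenfunction_S3 (lambda mu : R[i]) f :=
  [/\ csmooth_on [set x | x != 0] (ray_ext f),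
      forall p, stau f p = lambda * f p
    & forall p, skappa f f p = mu * f p ^+ 2].

Definition sdiff f p v : R[i] := cderiv (ray_ext f) (val p) v.

Definition regular_value f (c : R[i]) :=
  forall p, f p = c ->
    forall w : R[i], exists2 v, tangent p v & sdiff f p v = w.

(* [h] is, in the neighbourhood [U] of [p], a smooth defining function with
   nonvanishing gradient for [Sigma]; outside [U] nothing is asked of [h]. *)
Definition local_defining_function (Sigma : set (S3 R)) p h :=
  exists U : set ('rV[R]_4),
    [/\ open U, U (val p), smooth_on U (ray_ext h),
        forall q, U (val q) -> (Sigma q <-> h q = 0)
      & forall q, U (val q) -> Sigma q -> sgrad h q != 0].

Definition embedded_surface (Sigma : set (S3 R)) :=
  forall p, Sigma p -> exists h, local_defining_function Sigma p h.

Definition unit_normal h q : 'rV[R]_4 := (enorm (sgrad h q))^-1 *: sgrad h q.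

(* Second fundamental form in the sphere of the level surface of [h] through
   [p]; [v] and [w] are meant to be tangent to that surface, and then the
   Euclidean derivative may replace the Levi-Civita one. *)
Definition second_fundamental_form h p v w : R :=
  - dot ('D_v (ray_ext (unit_normal h)) (val p)) w.

(* Orthogonal projection of [R^4] onto the tangent plane at [p] of the level
   surface of [h]. *)
Definition proj_tangent h p v : 'rV[R]_4 :=
  v - dot v (val p) *: val p - dot v (unit_normal h p) *: unit_normal h p.

(* Half the trace over the tangent plane: if [Pi] is the orthogonal projection
   onto a subspace, the trace of a bilinear form [B] on that subspace is
   [\sum_i B (Pi e_i) (Pi e_i)]. *)
Definition mean_curvature h p : R :=
  2^-1 * \sum_(i < 4) second_fundamental_form h p
                        (proj_tangent h p (e_ R i)) (proj_tangent h p (e_ R i)).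

(* The choice of [h] affects [mean_curvature] only by a sign. *)
Definition minimal_surface (Sigma : set (S3 R)) :=
  embedded_surface Sigma /\
  forall p h, Sigma p -> local_defining_function Sigma p h ->
    mean_curvature h p = 0.

End Sphere.

Section Statement.
Variable R : realType.

Definition peval (F : mpoly.mpoly 4 R[i]) (x : 'rV[R]_4) : R[i] :=
  mpoly.meval (fun i => (x 0 i)%:C) F.

Definition homogeneous (F : mpoly.mpoly 4 R[i]) :=
  exists d : nat, F \is mpoly.ishomog1 d (@mpoly.mdeg 4).

Definition given_by (f : S3 R -> R[i]) (F : mpoly.mpoly 4 R[i]) :=
  [/\ homogeneous F,
      eigenfunction_E4 0 0 (peval F)
    & forall p : S3 R, f p = peval F (val p)].

Definition line (alpha : R[i]) : set R[i] :=
  [set z | complex.Re alpha * complex.Re z + complex.Im alpha * complex.Im z = 0].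

Definition P_ (F : mpoly.mpoly 4 R[i]) (alpha : R[i]) (x : 'rV[R]_4) : R :=
  complex.Re alpha * complex.Re (peval F x)
  + complex.Im alpha * complex.Im (peval F x).

Definition isometry_between (A B : set ('rV[R]_4)) (Phi : 'rV[R]_4 -> 'rV[R]_4) :=
  set_bij A B Phi /\
  forall x y, A x -> A y -> enorm (Phi x - Phi y) = enorm (x - y).

End Statement.

(* Main.v *)
Require Import Defs.
From mathcomp Require Import all_boot all_order all_algebra.
From mathcomp Require Import all_classical all_reals all_analysis.
From mathcomp Require Import complex ring lra.
From mathcomp Require mpoly.
Import (canonicals, coercions) mpoly.
Import Order.TTheory GRing.Theory Num.Theory.
Import numFieldNormedType.Exports.
Local Open Scope classical_set_scope.
Local Open Scope ring_scope.
Local Open Scope complex_scope.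

Set Implicit Arguments.
Unset Strict Implicit.
Unset Printing Implicit Defensive.

(** The theorem rests on one structural fact: [F] is holomorphic for some
    orthogonal complex structure [J] of R^4.  If [d] is the degree of [F], the
    rotation [c + s J] with [c^2 + s^2 = 1] then multiplies [F] by
    [(c + i s)^d].  Every complex number of modulus 1 is such a power, so
    these rotations carry any of the surfaces f^-1(l_alpha) to any other
    one; this is part (1), and it makes the condition of part (2) independent
    of alpha.

    Holomorphy.  The gradient [G] of [F] is a null vector, [G . G = 0].  The
    Laplacian of this identity gives [tr H^2 = 0] for the Hessian [H] of the
    harmonic polynomial [F].  Through [G] pass two null planes, one of each
    ruling of the null cone of C^4; let [X] and [Y] be directions that
    complete [G] to bases of the two planes.  Since [H G = 0] and [tr H = 0],
    [H X Y] vanishes, and [tr H^2 = 0] then says [H X X * H Y Y = 0]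
    ([null_hessian_factor]).  Polynomials form an integral domain, so one
    factor vanishes identically.  The slope that distinguishes the null
    planes of the corresponding ruling is a quotient of two derivatives of [F];
    the vanishing makes its differential a multiple of [dF], and Euler's
    identity makes this multiple zero, because the slope has degree 0 and
    [F] has positive degree ([null_hessian_ratio], [constant_ratio]).  So
    [G] stays in one constant null plane, and such a plane is the same thing
    as a [J] with [J G = i G] ([orthogonal_structure]).

    Minimality.  Write [P] for P_alpha.  Two functions with the same zero set
    and with nonzero gradients have, at a common zero, proportional gradients
    and, on the tangent space, proportional Hessians
    ([level_set_comparison]).  Hence the mean curvature computed with any
    defining function is a nonzero multiple of the trace of Hess P on the
    tangent plane of the surface.  The full trace is 0 because [P] is
    harmonic, the radial term is 0 by Euler's identity, and what is left is
    the term of the normal direction, a multiple of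
    Hess P (grad P, grad P) ([mean_curvature_eq0]).

    Regularity of the value 0 is used twice: it forces [d > 0], and it gives
    [G <> 0] at the zeros of [F].  At the other points [G <> 0] by Euler's
    identity.  As [G] is null, its real projections grad P_alpha then vanish
    nowhere on the sphere ([grad_P_neq0]), so the surfaces are embedded. *)

Local Notation mpoly := mpoly.mpoly.
Local Notation mderiv := mpoly.mderiv.
Local Notation meval := mpoly.meval.
Local Notation "c %:MP" := (mpoly.mpolyC _ c) (at level 1, format "c %:MP").
Local Notation var i := (mpoly.mpolyX _ (mpoly.mnm1 i)).

(** * The Hessian of a function with null gradient *)

(** The letters stand for derivatives of a function [F] along a null frame
    1, 1b, 2, 2b, in which [G . G] is [2 (F_1 F_1b + F_2 F_2b)] up to scale:
    [p, w, q, r] are [F_1, F_1b, F_2, F_2b], [p2b] is the derivative of [p] along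
    2b, and so on.
    The hypotheses say that [G] is null, that [F] is harmonic, that the
    derivatives of [G . G] vanish, and that [tr H^2 = 0].  The two factors are
    [H X X] and [H Y Y] for [X = w D_2 - q D_1b] and [Y = w D_2b - r D_1b],
    which span the two null planes through [G] together with [G].
    Multiplied by [w^4], [tr H^2] is their product, up to a constant. *)
Lemma null_hessian_factor (A : idomainType)
    (p w q r p1 p1b p2 p2b w1b w2 w2b q2 q2b r2b : A) :
  p * w + q * r = 0 ->
  p1b + q2b = 0 ->
  p1 * w + p * p1b + p2 * r + q * p2b = 0 ->
  p1b * w + p * w1b + w2 * r + q * w2b = 0 ->
  p2 * w + p * w2 + q2 * r + q * q2b = 0 ->
  p2b * w + p * w2b + q2b * r + q * r2b = 0 ->
  p1b ^+ 2 + q2b ^+ 2 + p1 * w1b + q2 * r2b + 2 * (w2 * p2b) + 2 * (p2 * w2b) = 0 ->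
  (w ^+ 2 * q2 - 2 * (q * w * w2) + q ^+ 2 * w1b) *
  (w ^+ 2 * r2b - 2 * (r * w * w2b) + r ^+ 2 * w1b) = 0.
Proof.
move=> null harm e1 e1b e2 e2b boch.
have hq : q2b = - p1b by apply/eqP; rewrite -subr_eq0 opprK addrC harm.
(* The equations [H G = 0] are solved for the second derivatives that involve
   direction 1, after multiplication by powers of [w]. *)
pose U := q * r * w1b - w * w2 * r - w * q * w2b.
have U1 : w ^+ 2 * p1b = U.
  rewrite /U; apply/eqP; rewrite -subr_eq0; apply/eqP.
  transitivity (w * (p1b * w + p * w1b + w2 * r + q * w2b)
                - w1b * (p * w + q * r)); first by ring.
  by rewrite e1b null; ring.
have U2 : w ^+ 3 * p2 = w * q * r * w2 - w ^+ 2 * q2 * r + q * U.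
  rewrite -U1; apply/eqP; rewrite -subr_eq0; apply/eqP.
  transitivity (w ^+ 2 * (p2 * w + p * w2 + q2 * r + q * q2b)
                - w * w2 * (p * w + q * r) - w ^+ 2 * q * (p1b + q2b)); first by ring.
  by rewrite e2 null harm; ring.
have U2b : w ^+ 3 * p2b = w * q * r * w2b - w ^+ 2 * q * r2b + r * U.
  rewrite -U1; apply/eqP; rewrite -subr_eq0; apply/eqP.
  transitivity (w ^+ 2 * (p2b * w + p * w2b + q2b * r + q * r2b)
                - w * w2b * (p * w + q * r) - w ^+ 2 * r * (p1b + q2b)); first by ring.
  by rewrite e2b null harm; ring.
have U3 : w ^+ 4 * p1 = q * r * U - r * (w ^+ 3 * p2) - q * (w ^+ 3 * p2b).
  rewrite -U1; apply/eqP; rewrite -subr_eq0; apply/eqP.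
  transitivity (w ^+ 3 * (p1 * w + p * p1b + p2 * r + q * p2b)
                - w ^+ 2 * p1b * (p * w + q * r)); first by ring.
  by rewrite e1 null; ring.
transitivity (w ^+ 4 * (p1b ^+ 2 + q2b ^+ 2 + p1 * w1b + q2 * r2b
                + 2 * (w2 * p2b) + 2 * (p2 * w2b))); last by rewrite boch mulr0.
rewrite hq.
transitivity (2 * (w ^+ 2 * p1b) ^+ 2 + w ^+ 4 * p1 * w1b + w ^+ 4 * q2 * r2b
  + 2 * (w * w2 * (w ^+ 3 * p2b)) + 2 * (w * w2b * (w ^+ 3 * p2))); last by ring.
rewrite U3 U2 U2b U1 /U; ring.
Qed.

(** When [H X X = 0], the derivatives of the slope [q / w] along the frame are
    proportional to those of [F]; [s1b] is the numerator of its derivative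
    along 1b.  The [e]'s are the coordinates of the Euler field in the frame
    and [F] stands for [d F]: as [q] and [w] have the same degree [k], the
    Euler field kills [q / w] but not [F], so the factor of proportionality
    vanishes. *)
Lemma null_hessian_ratio (A : idomainType)
    (p w q r p1b p2 w1b w2 w2b q2 q2b F e1 e1b e2 e2b k : A) :
  w != 0 -> p * w + q * r = 0 ->
  p1b + q2b = 0 ->
  p1b * w + p * w1b + w2 * r + q * w2b = 0 ->
  p2 * w + p * w2 + q2 * r + q * q2b = 0 ->
  w ^+ 2 * q2 - 2 * (q * w * w2) + q ^+ 2 * w1b = 0 ->
  e1 * p + e1b * w + e2 * q + e2b * r = F ->
  F != 0 ->
  e1 * p2 + e1b * w2 + e2 * q2 + e2b * q2b = k * q ->
  e1 * p1b + e1b * w1b + e2 * w2 + e2b * w2b = k * w ->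
  [/\ w * p2 = q * p1b, w * w2 = q * w1b, w * q2 = q * w2 & w * q2b = q * w2b].
Proof.
move=> w0 null harm e_1b e_2 hA eulF F0 eulq eulw.
pose s1b := w * w2 - q * w1b.
have h2 : w * (w * q2 - q * w2) = q * s1b.
  by apply/eqP; rewrite -subr_eq0 -hA /s1b; apply/eqP; ring.
have h2b : w * (w * q2b - q * w2b) = r * s1b.
  apply/eqP; rewrite -subr_eq0; apply/eqP; rewrite /s1b.
  transitivity (w ^+ 2 * (p1b + q2b) + w1b * (p * w + q * r)
    - w * (p1b * w + p * w1b + w2 * r + q * w2b)); first by ring.
  by rewrite harm null e_1b; ring.
have h1 : w * (w * p2 - q * p1b) = p * s1b.
  apply: (mulfI w0); apply/eqP; rewrite -subr_eq0; apply/eqP; rewrite /s1b.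
  transitivity (w ^+ 2 * (p2 * w + p * w2 + q2 * r + q * q2b)
      - 2 * (w * w2) * (p * w + q * r) + q * w1b * (p * w + q * r)
      - w ^+ 2 * q * (p1b + q2b)
     - r * (w ^+ 2 * q2 - 2 * (q * w * w2) + q ^+ 2 * w1b)); first by ring.
  by rewrite e_2 null hA harm; ring.
have s0 : s1b = 0.
  apply: (mulfI F0); rewrite mulr0 -eulF.
  transitivity (e1 * (p * s1b) + e1b * (w * s1b) + e2 * (q * s1b) + e2b * (r * s1b)).
    by ring.
  rewrite -h1 -h2 -h2b /s1b.
  transitivity (w * (w * (e1 * p2 + e1b * w2 + e2 * q2 + e2b * q2b)
    - q * (e1 * p1b + e1b * w1b + e2 * w2 + e2b * w2b))); first by ring.
  by rewrite eulq eulw; ring.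
have H x y : w * (x - y) = 0 -> x = y.
  by move/eqP; rewrite mulf_eq0 (negbTE w0) subr_eq0 => /eqP.
by split; apply: H; rewrite ?h1 ?h2 ?h2b -/s1b ?s0 mulr0.
Qed.

(** * Directional derivatives of polynomials *)

Section MPoly.
Variables (n : nat) (K : numFieldType).
Implicit Types (F G : mpoly n K) (x v : 'I_n -> K).

(** Properties compatible with sums and products need only be checked on
    constants and variables. *)
Lemma mpoly_ring_ind (P : mpoly n K -> Prop) :
  (forall c, P (c%:MP)) -> (forall i, P (var i)) ->
  (forall F G, P F -> P G -> P (F + G)) ->
  (forall F G, P F -> P G -> P (F * G)) -> forall F, P F.
Proof.
move=> PC PX PD PM; elim/mpoly.mpolyind; first by rewrite -mpoly.mpolyC0.
move=> c m F _ _ PF; apply: (PD) => //.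
rewrite -mpoly.mul_mpolyC; apply: (PM) => //.
rewrite mpoly.mpolyXE_id; apply: (big_ind P) => [|G H|i _]; [exact: (PC 1) | exact: PM |].
by elim: (m i) => [|k IH]; [exact: (PC 1) | rewrite exprS; exact: (PM)].
Qed.

Definition cder v F := \sum_i (v i)%:MP * mderiv i F.

Lemma cderC v c : cder v c%:MP = 0.
Proof. by rewrite /cder big1 // => i _; rewrite mpoly.mderivC mulr0. Qed.

Lemma cderD v F G : cder v (F + G) = cder v F + cder v G.
Proof.
by rewrite -big_split; apply: eq_bigr => i _; rewrite mpoly.mderivD mulrDr.
Qed.

Lemma cderM v F G : cder v (F * G) = cder v F * G + F * cder v G.
Proof.
rewrite /cder mulr_suml mulr_sumr -big_split; apply: eq_bigr => i _ /=.
rewrite mpoly.mderivM; ring.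
Qed.

Lemma mderiv_var i j : mderiv i (var j) = ((i == j)%:R)%:MP :> mpoly n K.
Proof.
rewrite mpoly.mderivX mpoly.mnm1E eq_sym; case: eqVneq => [<-|_]; last first.
  by rewrite scale0r mpoly.mpolyC0.
rewrite scale1r.
have -> : mpoly.mnm_sub (mpoly.mnm1 i) (mpoly.mnm1 i) = mpoly.mnm0.
  by apply/mpoly.mnmP => k; rewrite mpoly.mnmBE subnn mpoly.mnm0E.
by rewrite mpoly.mpolyX0 mpoly.mpolyC1.
Qed.

Lemma cder_delta i F : cder (fun j => (j == i)%:R) F = mderiv i F.
Proof.
rewrite /cder (bigD1 i) //= big1 ?addr0 => [|j /negbTE ji].
  by rewrite eqxx mpoly.mpolyC1 mul1r.
by rewrite ji mpoly.mpolyC0 mul0r.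
Qed.

Lemma cder_var v i : cder v (var i) = (v i)%:MP.
Proof.
rewrite /cder (bigD1 i) //= big1 ?addr0 => [|j /negbTE ji]; last first.
  by rewrite mderiv_var ji mpoly.mpolyC0 mulr0.
by rewrite mderiv_var eqxx mpoly.mpolyC1 mulr1.
Qed.

Lemma cder_mderiv v i F : cder v (mderiv i F) = mderiv i (cder v F).
Proof.
rewrite /cder linear_sum; apply: eq_bigr => j _.
by rewrite /= mpoly.mderiv_mulC mpoly.mderiv_comm.
Qed.

Lemma cder_comm v w F : cder v (cder w F) = cder w (cder v F).
Proof.
have cder0 : cder v 0 = 0 by rewrite -mpoly.mpolyC0 cderC.
rewrite [cder w F]/cder (big_morph (cder v) (cderD v) cder0); apply: eq_bigr => i _.
by rewrite cderM cderC mul0r add0r cder_mderiv.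
Qed.

(** The polynomial [t |-> F (x + t v)]; it reduces statements on several
    variables to univariate polynomials. *)
Definition on_line x v F : {poly K} :=
  mpoly.mmap polyC (fun i => (x i)%:P + (v i)%:P * 'X) F.

Lemma horner_on_line x v F t :
  (on_line x v F).[t] = meval (fun i => x i + v i * t) F.
Proof.
elim/mpoly_ring_ind: F => [c|i|F G hF hG|F G hF hG].
- by rewrite /on_line mpoly.mmapC mpoly.mevalC hornerC.
- by rewrite /on_line mpoly.mmapX mpoly.mmap1U mpoly.mevalXU !hornerE.
- by rewrite /on_line mpoly.mmapD mpoly.mevalD hornerD hF hG.
- by rewrite /on_line rmorphM mpoly.mevalM hornerM hF hG.
Qed.

Lemma deriv_on_line x v F : (on_line x v F)^`() = on_line x v (cder v F).
Proof.
elim/mpoly_ring_ind: F => [c|i|F G hF hG|F G hF hG].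
- by rewrite cderC /on_line mpoly.mmapC mpoly.mmap0 derivC.
- rewrite cder_var /on_line mpoly.mmapC mpoly.mmapX mpoly.mmap1U !poly.derivE.
  ring.
- by rewrite cderD /on_line !mpoly.mmapD derivD -!/(on_line _ _ _) hF hG.
- rewrite cderM /on_line mpoly.mmapD !rmorphM derivM -!/(on_line _ _ _) hF hG.
  by [].
Qed.

Lemma poly_deriv_eq0 (p : {poly K}) : p^`() = 0 -> p = (p.[0])%:P.
Proof.
move=> p0; apply/polyP => -[|i]; rewrite coefC /=; first by rewrite horner_coef0.
have /eqP := congr1 (fun q : {poly K} => q`_i) p0.
by rewrite coef_deriv coef0 -mulr_natr mulf_eq0 pnatr_eq0 orbF => /eqP.
Qed.

(** The restriction of [F] to the line through [x] in the direction [v] has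
    zero derivative, hence is constant.  The direction [v] may be complex. *)
Lemma cder_eq0_translate v F x :
  cder v F = 0 -> meval (fun i => x i + v i) F = meval x F.
Proof.
move=> h; have /poly_deriv_eq0 e : (on_line x v F)^`() = 0.
  by rewrite deriv_on_line h /on_line mpoly.mmap0.
transitivity ((on_line x v F).[1]).
  by rewrite horner_on_line; apply: mpoly.meval_eq => i; rewrite mulr1.
rewrite e hornerC horner_on_line; apply: mpoly.meval_eq => i.
by rewrite mulr0 addr0.
Qed.

Lemma poly_nat_roots (p : {poly K}) : (forall t : nat, p.[t%:R] = 0) -> p = 0.
Proof.
move=> h; apply/eqP; apply: contraT => p0.
have := max_poly_roots p0 (rs := [seq t%:R | t <- iota 0 (size p)]).
rewrite size_map size_iota ltnn; apply.
  by apply/allP => _ /mapP[t _ ->]; rewrite rootE h.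
by rewrite map_inj_uniq ?iota_uniq // => i j /eqP; rewrite eqr_nat => /eqP.
Qed.

(** Vanishing at the points with natural coordinates passes to the partial
    derivatives, since the restriction to a coordinate line has infinitely many
    roots; at the origin it then kills all Taylor coefficients.  Natural
    points are real, so a complex polynomial vanishing on R^n is zero. *)
Lemma mpoly_nat_zeros F :
  (forall x : 'I_n -> nat, meval (fun i => (x i)%:R) F = 0) -> F = 0.
Proof.
pose Z F := forall x : 'I_n -> nat, meval (fun i => (x i)%:R) F = 0.
rewrite -/(Z F).
have Zd G i : Z G -> Z (mderiv i G).
  move=> ZG x; pose e j : K := (j == i)%:R; rewrite -cder_delta -/e.
  have L0 : on_line (fun i => (x i)%:R) e G = 0.
    apply: poly_nat_roots => t; rewrite horner_on_line.
    rewrite -[RHS](ZG (fun j => x j + (j == i) * t)%N).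
    by apply: mpoly.meval_eq => j; rewrite natrD natrM.
  have := congr1 (horner^~ 0) (deriv_on_line (fun i => (x i)%:R) e G).
  rewrite L0 deriv0 horner0 horner_on_line => E; rewrite [RHS]E.
  by apply: mpoly.meval_eq => j; rewrite mulr0 addr0.
have Zdm G m : Z G -> Z (mpoly.mderivm m G).
  rewrite mpoly.mderivm_foldr; move: (flatten _) => s ZG.
  by elim: s => //= i s; apply: Zd.
move=> ZF; apply/mpoly.mpolyP => m; rewrite mpoly.mcoeff0.
have := Zdm _ m ZF (fun=> 0%N).
have -> G : meval (fun=> 0%:R) G = mpoly.mcoeff mpoly.mnm0 G.
  elim/mpoly_ring_ind: G => [c|i|G H hG hH|G H hG hH].
  - by rewrite mpoly.mevalC mpoly.mcoeffC eqxx mulr1.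
  - by rewrite mpoly.mevalXU mpoly.mcoeffX mpoly.mnm1_eq0.
  - by rewrite mpoly.mevalD mpoly.mcoeffD hG hH.
  - by rewrite mpoly.mevalM rmorphM /= hG hH.
rewrite mpoly.mcoeff_mderivm mpoly.addm0 => /eqP.
rewrite -mulr_natr mulf_eq0 => /orP[/eqP//|].
rewrite pnatr_eq0 => /eqP E; suff: (0 < 0)%N by [].
by rewrite -{2}E prodn_gt0 // => i; rewrite ffactnn fact_gt0.
Qed.

Lemma mpoly_euler F d : F \is mpoly.ishomog1 d (@mpoly.mdeg n) ->
  \sum_i var i * mderiv i F = d%:R * F.
Proof.
move/mpoly.dhomogP => hF; rewrite {1 2}[F]mpoly.mpolyE mulr_sumr.
under eq_bigr do rewrite linear_sum mulr_sumr.
rewrite exchange_big; apply: eq_big_seq => m /hF <- /=.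
rewrite mpoly.mdegE natr_sum mulr_suml; apply: eq_bigr => i _.
rewrite mpoly.mderivZ mpoly.mderivX -!scalerAr; congr (_ *: _).
rewrite scaler_nat mulr_natl; case: (posnP (m i)) => [->|mi]; first by rewrite !mulr0n.
rewrite -mpoly.mpolyXD mpoly.addmC mpoly.submK //.
by apply/mpoly.mnm_lepP => j; rewrite mpoly.mnm1E; case: eqP => // <-.
Qed.

(** The equation says that [r / w] is constant near 0.  On coefficients: if
    [r] starts at order [k > 0], the left-hand side has the term
    [k w_0 r_k] of degree [k - 1], and the right-hand side has none. *)
Lemma wronskian_eq0 (w r : {poly K}) :
  w.[0] != 0 -> r.[0] = 0 -> w * r^`() = r * w^`() -> r = 0.
Proof.
rewrite !horner_coef0 => w0 r0 h; apply/polyP => k; rewrite coef0.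
elim/ltn_ind: k => -[|k] IH //.
have := congr1 (fun p : {poly K} => p`_k) h; rewrite /= !coefM.
rewrite big_ord_recl big1 => [|i _]; last first.
  rewrite coef_deriv IH ?mul0rn ?mulr0 //= /bump /= add1n ltnS.
  by rewrite ltn_subrL /=; case: (k) i => [[]|].
rewrite big1 => [|i _]; last by rewrite IH ?mul0r.
rewrite addr0 subn0 coef_deriv -mulr_natr => /eqP.
by rewrite !mulf_eq0 (negbTE w0) pnatr_eq0 orbF => /eqP.
Qed.

(** The constant is the value of [q / w] at a point where [w] does not
    vanish; [q - c w] satisfies the same equation and vanishes at that point,
    hence on every line through it. *)
Lemma proportional_of_wronskian (w q : mpoly n K) :
  w != 0 -> (forall i, w * mderiv i q = q * mderiv i w) ->
  exists c, q = c%:MP * w.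
Proof.
move=> w0 h.
have [x wx] : exists x : 'I_n -> nat, meval (fun i => (x i)%:R) w != 0.
  apply: contrapT => /forallNP hx; case/eqP: w0; apply: mpoly_nat_zeros => x.
  by apply/eqP; rewrite -[_ == _]negbK; apply/negP/hx.
set X : 'I_n -> K := fun i => (x i)%:R in wx.
pose c := meval X q / meval X w; exists c.
apply/eqP; rewrite -subr_eq0; apply/eqP; apply: mpoly_nat_zeros => y.
pose v i : K := (y i)%:R - (x i)%:R.
set r := q - _.
have dr u : w * cder u r = r * cder u w.
  rewrite /cder !mulr_sumr; apply: eq_bigr => i _.
  rewrite /r mpoly.mderivB mpoly.mderiv_mulC.
  transitivity ((u i)%:MP * (w * mderiv i q - c%:MP * w * mderiv i w)); first by ring.
  by rewrite h; ring.
have l0 p : (on_line X v p).[0] = meval X p.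
  by rewrite horner_on_line; apply: mpoly.meval_eq => i; rewrite mulr0 addr0.
have : on_line X v r = 0.
  apply: (@wronskian_eq0 (on_line X v w)); rewrite ?l0 //.
    by rewrite /r mpoly.mevalB mpoly.mevalM mpoly.mevalC /c divfK ?subrr.
  by rewrite !deriv_on_line /on_line -!rmorphM /= -/(on_line _ _ _) dr.
move/(congr1 (fun p : {poly K} => p.[1])); rewrite horner0 horner_on_line => <-.
by apply: mpoly.meval_eq => i; rewrite mulr1 /v /X; ring.
Qed.

(** Differentiation lowers the degree by one.  Expressing homogeneity by
    Euler's identity allows the degree [k] to become negative. *)
Lemma euler_cder k v F :
  \sum_i var i * mderiv i F = k%:MP * F ->
  \sum_i var i * mderiv i (cder v F) = (k - 1)%:MP * cder v F.
Proof.
move=> h; have : cder v (\sum_i var i * mderiv i F) = cder v (k%:MP * F) by rewrite h.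
rewrite cderM cderC mul0r add0r mpoly.mpolyCB mpoly.mpolyC1 mulrBl mul1r => <-.
have cder0 : cder v 0 = 0 by rewrite -mpoly.mpolyC0 cderC.
rewrite (big_morph (cder v) (cderD v) cder0) [X in _ = _ - X]/cder -sumrB.
by apply: eq_bigr => i _; rewrite cderM cder_var cder_mderiv addrAC subrr add0r.
Qed.
End MPoly.

(** * Harmonic polynomials with null gradient *)

(** The sum of one derivative along 1 and one along 2 of the two equations
    that express [H G = 0] in the directions 1b and 2b, that is the Laplacian
    of [G . G]: the third derivatives gather into Laplacians of [p, w, q, r]
    and drop out, leaving [tr H^2]. *)
Lemma bochner_expansion (A : comNzRingType)
    (p w q r p1 p1b p2 p2b w1b w2 w2b q2 q2b r2b : A)
    (pab wab qab rab pce wce qce rce : A) :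
  pab + pce = 0 -> wab + wce = 0 -> qab + qce = 0 -> rab + rce = 0 ->
  pab * w + p1b * p1b + (p1 * w1b + p * wab) + (qab * r + w2 * p2b)
    + (p2 * w2b + q * rab)
  + (pce * w + p2b * w2 + (p2 * w2b + p * wce) + (qce * r + q2b * q2b)
    + (q2 * r2b + q * rce)) = 0 ->
  p1b ^+ 2 + q2b ^+ 2 + p1 * w1b + q2 * r2b + 2 * (w2 * p2b) + 2 * (p2 * w2b) = 0.
Proof.
move=> hp hw hq hr <-.
transitivity (p1b ^+ 2 + q2b ^+ 2 + p1 * w1b + q2 * r2b + 2 * (w2 * p2b)
  + 2 * (p2 * w2b) + w * (pab + pce) + p * (wab + wce) + r * (qab + qce)
  + q * (rab + rce)); first by rewrite hp hw hq hr; ring.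
ring.
Qed.

Section NullFrame.
Variables (n : nat) (K : numFieldType) (F : mpoly n K) (d : K).
Hypothesis euler : \sum_i var i * mderiv i F = d%:MP * F.
Hypothesis d0 : d != 0.

(** In a frame whose only nonzero products are [a . b = c . e], the two
    equations are [G . G = 0] and harmonicity. *)
Definition null_harmonic (a b c e : 'I_n -> K) :=
  cder a F * cder b F + cder c F * cder e F = 0 /\
  cder b (cder a F) + cder e (cder c F) = 0.

(** The partial derivatives are recovered from the four directional ones:
    [a, b, c, e] is a basis.  It is stated on derivations because only this is
    used of it. *)
Definition derivation_frame (a b c e : 'I_n -> K) :=
  exists ta tb tc te : 'I_n -> K, forall i (G : mpoly n K),
    mderiv i G = (ta i)%:MP * cder a G + (tb i)%:MP * cder b G
               + (tc i)%:MP * cder c G + (te i)%:MP * cder e G.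

Lemma frame_euler a b c e : derivation_frame a b c e ->
  exists ea eb ec ee : mpoly n K, forall G,
    ea * cder a G + eb * cder b G + ec * cder c G + ee * cder e G
    = \sum_i var i * mderiv i G.
Proof.
move=> [ta [tb [tc [te h]]]].
exists (\sum_i var i * (ta i)%:MP), (\sum_i var i * (tb i)%:MP),
  (\sum_i var i * (tc i)%:MP), (\sum_i var i * (te i)%:MP) => G.
rewrite !mulr_suml -!big_split; apply: eq_bigr => i _ /=.
rewrite (h i G); ring.
Qed.

Lemma null_derivative a b c e x : null_harmonic a b c e ->
  cder x (cder a F) * cder b F + cder a F * cder x (cder b F)
  + cder x (cder c F) * cder e F + cder c F * cder x (cder e F) = 0.
Proof.
case=> /(congr1 (cder x)); rewrite -[in X in _ = X -> _]mpoly.mpolyC0 cderC.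
by rewrite cderD !cderM addrA.
Qed.

(** The slope of the null plane through the gradient is constant as soon as
    the Hessian vanishes on the direction [X] of [null_hessian_factor]. *)
Lemma constant_ratio a b c e : derivation_frame a b c e -> null_harmonic a b c e ->
  cder b F != 0 ->
  cder b F ^+ 2 * cder c (cder c F)
    - 2 * (cder c F * cder b F * cder c (cder b F))
    + cder c F ^+ 2 * cder b (cder b F) = 0 ->
  exists t, cder c F = t%:MP * cder b F /\ cder a F = - t%:MP * cder e F.
Proof.
move=> fr nh w0 hA; have [null harm] := nh.
have F0 : F != 0.
  by apply: contraNneq w0 => ->; rewrite -mpoly.mpolyC0 cderC.
have [ea [eb [ec [ee E]]]] := frame_euler fr.
have [ta [tb [tc [te h]]]] := fr.
have nb := null_derivative b nh.
have nc := null_derivative c nh.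
rewrite [cder b (cder e F)]cder_comm [cder b (cder c F)]cder_comm in nb.
rewrite [cder c (cder e F)]cder_comm in nc.
have eF : ea * cder a F + eb * cder b F + ec * cder c F + ee * cder e F = d%:MP * F.
  by rewrite E euler.
have dF0 : d%:MP * F != 0 by rewrite mulf_neq0 // mpoly.mpolyC_eq0.
have eq := E (cder c F); rewrite (euler_cder c euler) [cder a (cder c F)]cder_comm
  [cder b (cder c F)]cder_comm in eq.
have ew := E (cder b F); rewrite (euler_cder b euler) [cder a (cder b F)]cder_comm in ew.
have [s1 s2 s3 s4] := null_hessian_ratio w0 null harm nb nc hA eF dF0 eq ew.
have [t ht] : exists t, cder c F = t%:MP * cder b F.
  apply: proportional_of_wronskian => // i; rewrite !h !mulrDr.
  rewrite [cder a (cder c F)]cder_comm [cder b (cder c F)]cder_comm.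
  rewrite [cder a (cder b F)]cder_comm.
  by rewrite ![_ * (_%:MP * _)]mulrCA s1 s2 s3 s4.
exists t; split=> //; apply: (mulIf w0).
move/eqP: null; rewrite addr_eq0 => /eqP ->; rewrite ht; ring.
Qed.

Lemma null_harmonic_swap a b c e : null_harmonic a b c e -> null_harmonic a b e c.
Proof.
by case=> h1 h2; split; [rewrite [cder e F * _]mulrC | rewrite [cder c _]cder_comm].
Qed.

Lemma frame_swap a b c e : derivation_frame a b c e -> derivation_frame a b e c.
Proof.
case=> ta [tb [tc [te h]]]; exists ta, tb, te, tc => i G.
by rewrite h addrAC.
Qed.

(** The gradient is orthogonal to the constant null plane spanned by
    [a0 c - a1 b] and [a0 a + a1 e], hence lies in it.  The exchange of [c] and
    [e] exchanges the two rulings. *)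
Definition null_plane a b c e := exists a0 a1 : K,
  [/\ (a0 != 0) || (a1 != 0), a0%:MP * cder c F = a1%:MP * cder b F
    & a0%:MP * cder a F = - (a1%:MP * cder e F)].

Lemma bochner_null a b c e : null_harmonic a b c e ->
  cder b (cder a F) ^+ 2 + cder e (cder c F) ^+ 2
  + cder a (cder a F) * cder b (cder b F) + cder c (cder c F) * cder e (cder e F)
  + 2 * (cder c (cder b F) * cder e (cder a F))
  + 2 * (cder c (cder a F) * cder e (cder b F)) = 0.
Proof.
move=> nh; have [_ harm] := nh.
have L x : cder a (cder b (cder x F)) + cder c (cder e (cder x F)) = 0.
  rewrite [cder b _]cder_comm [cder a _]cder_comm [cder e _]cder_comm [cder c _]cder_comm.
  rewrite [cder a _]cder_comm [cder c _]cder_comm -cderD harm.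
  by rewrite -mpoly.mpolyC0 cderC.
apply: (bochner_expansion (L a) (L b) (L c) (L e)).
have := congr2 +%R (congr1 (cder a) (null_derivative b nh))
                   (congr1 (cder c) (null_derivative e nh)).
rewrite -[in X in _ = X -> _]mpoly.mpolyC0 !cderC addr0 => E.
rewrite -[RHS]E !cderD !cderM.
rewrite [cder a (cder c F)]cder_comm [cder b (cder c F)]cder_comm.
rewrite [cder a (cder e F)]cder_comm [cder b (cder e F)]cder_comm.
by rewrite [cder c (cder e F)]cder_comm [cder a (cder b F)]cder_comm.
Qed.

(** The polynomial [H X X * H Y Y] is zero, so one of its factors is; the case
    where [cder b F] vanishes has to be treated apart because the slopes have
    that denominator. *)
Lemma gradient_in_null_plane a b c e : derivation_frame a b c e -> null_harmonic a b c e ->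
  null_plane a b c e \/ null_plane a b e c.
Proof.
move=> fr nh; have [null harm] := nh.
have [w0|w0] := eqVneq (cder b F) 0.
  have /eqP := null; rewrite w0 mulr0 add0r mulf_eq0 => /orP[]/eqP z; [right|left];
    by exists 0, 1; rewrite oner_eq0 orbT w0 z mpoly.mpolyC0 !(mul0r, mulr0) oppr0.
have half x y : derivation_frame a b x y -> null_harmonic a b x y ->
  cder b F ^+ 2 * cder x (cder x F)
    - 2 * (cder x F * cder b F * cder x (cder b F))
    + cder x F ^+ 2 * cder b (cder b F) = 0 -> null_plane a b x y.
  move=> frx nhx hx; have [t [h1 h2]] := constant_ratio frx nhx w0 hx.
  by exists 1, t; rewrite oner_neq0 mpoly.mpolyC1 !mul1r h1 h2 mulNr.
have na := null_derivative a nh.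
have nb := null_derivative b nh.
have nc := null_derivative c nh.
have ne := null_derivative e nh.
rewrite [cder a (cder b F)]cder_comm [cder a (cder c F)]cder_comm
  [cder a (cder e F)]cder_comm in na.
rewrite [cder b (cder e F)]cder_comm [cder b (cder c F)]cder_comm in nb.
rewrite [cder c (cder e F)]cder_comm in nc.
have /eqP := null_hessian_factor null harm na nb nc ne (bochner_null nh).
rewrite mulf_eq0 => /orP[]/eqP h; [left|right]; apply: half => //.
  exact: frame_swap.
exact: null_harmonic_swap.
Qed.
End NullFrame.

(** * The orthogonal complex structure *)

(** A null plane of slope [(x0 + i y0 : x1 + i y1)] is the i-eigenspace of the
    complex structure whose coordinates [k, al, be] are the image of the slope
    under the Hopf map, and [s = 1] or [-1] tells the two rulings apart.  Each
    relation is a combination of the two equations of the plane, with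
    coefficients the conjugate slopes. *)
Lemma hopf_relations (A : comNzRingType) (I x0 y0 x1 y1 s G0 G1 G2 G3 : A)
    (k := x0 ^+ 2 + y0 ^+ 2 - x1 ^+ 2 - y1 ^+ 2)
    (al := 2 * (y0 * x1 - x0 * y1)) (be := 2 * (x0 * x1 + y0 * y1)) :
  I * I = -1 -> s * s = 1 -> x0 ^+ 2 + y0 ^+ 2 + x1 ^+ 2 + y1 ^+ 2 = 1 ->
  (x0 + I * y0) * (G2 - I * s * G3) = (x1 + I * y1) * (G0 + I * G1) ->
  (x0 + I * y0) * (G0 - I * G1) = - ((x1 + I * y1) * (G2 + I * s * G3)) ->
  [/\ - k * G1 - al * G2 + s * be * G3 = I * G0,
      k * G0 + be * G2 + s * al * G3 = I * G1,
      al * G0 - be * G1 - s * k * G3 = I * G2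
    & - (s * be) * G0 - s * al * G1 + s * k * G2 = I * G3].
Proof.
move=> hI hs hn e1 e2.
pose E1 := (x0 + I * y0) * (G2 - I * s * G3) - (x1 + I * y1) * (G0 + I * G1).
pose E2 := (x0 + I * y0) * (G0 - I * G1) + (x1 + I * y1) * (G2 + I * s * G3).
have E10 : E1 = 0 by rewrite /E1 e1 subrr.
have E20 : E2 = 0 by rewrite /E2 e2 addNr.
have hx : x0 ^+ 2 = 1 - y0 ^+ 2 - x1 ^+ 2 - y1 ^+ 2 by rewrite -hn; ring.
have key (X Y Z : A) : X - Y = Z -> Z = 0 -> X = Y.
  by move=> <- /eqP; rewrite subr_eq0 => /eqP.
split.
- apply: (@key _ _ (- I * ((x0 - I * y0) * E2 - (x1 - I * y1) * E1))).
    by rewrite /E1 /E2 /k /al /be; ring: hI hs hx.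
  by rewrite E10 E20; ring.
- apply: (@key _ _ ((x0 - I * y0) * E2 + (x1 - I * y1) * E1)).
    by rewrite /E1 /E2 /k /al /be; ring: hI hs hx.
  by rewrite E10 E20; ring.
- apply: (@key _ _ (- I * ((x1 - I * y1) * E2 + (x0 - I * y0) * E1))).
    by rewrite /E1 /E2 /k /al /be; ring: hI hs hx.
  by rewrite E10 E20; ring.
- apply: (@key _ _ (- s * ((x1 - I * y1) * E2 - (x0 - I * y0) * E1))).
    by rewrite /E1 /E2 /k /al /be; ring: hI hs hx.
  by rewrite E10 E20; ring.
Qed.

Local Notation i0 := (@ord0 3).
Local Notation i1 := (lift (@ord0 3) (@ord0 2)).
Local Notation i2 := (lift (@ord0 3) (lift (@ord0 2) (@ord0 1))).
Local Notation i3 := (lift (@ord0 3) (lift (@ord0 2) (lift (@ord0 1) (@ord0 0)))).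

Lemma sum_ord4 (V : nmodType) (E : 'I_4 -> V) :
  \sum_i E i = E i0 + E i1 + E i2 + E i3.
Proof. by rewrite !big_ord_recl big_ord0 addr0 !addrA. Qed.

Lemma ord4_ind (P : 'I_4 -> Prop) : P i0 -> P i1 -> P i2 -> P i3 -> forall i, P i.
Proof.
move=> h0 h1 h2 h3 [[|[|[|[|//]]]] hi].
- by have <- : i0 = Ordinal hi by apply: val_inj.
- by have <- : i1 = Ordinal hi by apply: val_inj.
- by have <- : i2 = Ordinal hi by apply: val_inj.
- by have <- : i3 = Ordinal hi by apply: val_inj.
Qed.

Section Identities.
Variables (A : comNzRingType) (I h : A).
Hypotheses (hI : I * I = -1) (hh : h * 2 = 1).

(** The derivatives along the null vectors [D_x - i D_y] and [D_x + i D_y]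
    determine those along [x] and [y].  The zero terms and the factors [1] and
    [-1] match the general shape of [derivation_frame]. *)
Lemma pair_coords (x y z t : A) :
  [/\ x = h * (x + -1 * I * y) + h * (x + 1 * I * y) + 0 * z + 0 * t,
      y = h * I * (x + -1 * I * y) + - (h * I) * (x + 1 * I * y) + 0 * z + 0 * t,
      x = 0 * z + 0 * t + h * (x + -1 * I * y) + h * (x + 1 * I * y)
    & y = 0 * z + 0 * t + h * I * (x + -1 * I * y) + - (h * I) * (x + 1 * I * y)].
Proof.
have e u : u = h * 2 * u by rewrite hh mul1r.
by split; rewrite [LHS]e; ring: hI.
Qed.

Lemma pair_null (x y z t : A) :
  (x + -1 * I * y) * (x + 1 * I * y) + (z + -1 * I * t) * (z + 1 * I * t)
  = x ^+ 2 + y ^+ 2 + z ^+ 2 + t ^+ 2.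
Proof. by ring: hI. Qed.

Lemma pair_harm (x xy y z zt t : A) :
  x + -1 * I * xy + 1 * I * (xy + -1 * I * y)
  + (z + -1 * I * zt + 1 * I * (zt + -1 * I * t)) = x + y + z + t.
Proof. by ring: hI. Qed.
End Identities.

Definition hopf_matrix (A : comNzRingType) (k al be s : A) : 'M[A]_4 :=
  \matrix_(j, i) nth 0 (nth [::]
    [:: [:: 0; - k; - al; s * be];
        [:: k; 0; be; s * al];
        [:: al; - be; 0; - (s * k)];
        [:: - (s * be); - (s * al); s * k; 0]] j) i.

Lemma hopf_matrixT (A : comNzRingType) (k al be s : A) :
  (hopf_matrix k al be s)^T = - hopf_matrix k al be s.
Proof.
apply/matrixP => i j; rewrite !mxE.
by elim/ord4_ind: i; elim/ord4_ind: j; rewrite /= ?opprK ?oppr0.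
Qed.

Lemma hopf_matrix_sqr (A : comNzRingType) (k al be s : A) :
  k ^+ 2 + al ^+ 2 + be ^+ 2 = 1 -> s * s = 1 ->
  hopf_matrix k al be s *m hopf_matrix k al be s = - 1%:M.
Proof.
move=> hk hs; have hk' : k ^+ 2 = 1 - al ^+ 2 - be ^+ 2 by rewrite -hk; ring.
apply/matrixP => i j; rewrite !mxE sum_ord4 !mxE.
by elim/ord4_ind: i; elim/ord4_ind: j; rewrite /=; ring: hk' hs.
Qed.

Lemma sum_sqr4_gt0 (A : realDomainType) (x y z t : A) :
  ~~ [&& x == 0, y == 0, z == 0 & t == 0] -> 0 < x ^+ 2 + y ^+ 2 + z ^+ 2 + t ^+ 2.
Proof.
rewrite lt_def !addr_ge0 ?sqr_ge0 // andbT; apply: contraNneq => /eqP.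
by rewrite !paddr_eq0 ?addr_ge0 ?sqr_ge0 // !sqrf_eq0 -!andbA.
Qed.

Section Structure.
Variable R : rcfType.
Local Notation K := R[i].
Local Notation II := ('i%:MP : mpoly 4 K).

(** With [z = x_j + i x_k], the values [s = -1] and [s = 1] give twice the
    Wirtinger vector fields d/dz and d/dzbar. *)
Definition pair_vector (s : K) (j k : 'I_4) : 'I_4 -> K :=
  fun i => (i == j)%:R + s * 'i * (i == k)%:R.

Lemma cder_pair_vector s j k (F : mpoly 4 K) :
  cder (pair_vector s j k) F = mderiv j F + s%:MP * II * mderiv k F.
Proof.
have E l (c : K) : \sum_(i < 4) (c * (i == l)%:R)%:MP * mderiv i F = c%:MP * mderiv l F.
  rewrite (bigD1 l) //= big1 ?addr0 ?eqxx ?mulr1 // => i /negbTE ->.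
  by rewrite mulr0 mpoly.mpolyC0 mul0r.
rewrite /cder /pair_vector; under eq_bigr do
  rewrite -[(_ == j)%:R]mul1r mpoly.mpolyCD mulrDl.
by rewrite big_split /= !E mpoly.mpolyC1 mul1r mpoly.mpolyCM.
Qed.

Lemma sqr_II : II * II = -1.
Proof. by rewrite -mpoly.mpolyCM -expr2 sqr_i mpoly.mpolyCN mpoly.mpolyC1. Qed.

Local Notation va := (pair_vector (-1) i0 i1).
Local Notation vb := (pair_vector 1 i0 i1).
Local Notation vc := (pair_vector (-1) i2 i3).
Local Notation ve := (pair_vector 1 i2 i3).

Lemma pair_frame : derivation_frame va vb vc ve.
Proof.
pose h := (2^-1 : K); pose t := (2^-1 * 'i : K).
have hh : h%:MP * 2 = 1 :> mpoly 4 K.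
  rewrite -(mpoly.mpolyC_nat 4 K 2) -mpoly.mpolyCM /h.
  by rewrite mulVf ?pnatr_eq0 // mpoly.mpolyC1.
have tE : t%:MP = h%:MP * II by rewrite /t mpoly.mpolyCM.
pose pick4 (a b c e : K) (i : 'I_4) := nth 0 [:: a; b; c; e] i.
exists (pick4 h t 0 0), (pick4 h (-t) 0 0), (pick4 0 0 h t), (pick4 0 0 h (-t)).
move=> i G.
have [p0 p1 _ _] :=
  pair_coords sqr_II hh (mderiv i0 G) (mderiv i1 G) (cder vc G) (cder ve G).
have [_ _ p2 p3] :=
  pair_coords sqr_II hh (mderiv i2 G) (mderiv i3 G) (cder va G) (cder vb G).
rewrite !cder_pair_vector mpoly.mpolyCN mpoly.mpolyC1 in p0 p1 p2 p3 *.
have [t0 t1] : t%:MP = h%:MP * II /\ (- t)%:MP = - (h%:MP * II).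
  by rewrite mpoly.mpolyCN tE.
elim/ord4_ind: i; rewrite ![pick4 _ _ _ _ _]/= mpoly.mpolyC0.
- exact: p0.
- by rewrite t0 t1; exact: p1.
- exact: p2.
- by rewrite t0 t1; exact: p3.
Qed.

(** Normalization of homogeneous coordinates of a point of the complex projective
    line, with a real factor. *)
Lemma unit_pair (a0 a1 : K) : (a0 != 0) || (a1 != 0) ->
  exists N x0 y0 x1 y1 : R, [/\ N != 0, x0 ^+ 2 + y0 ^+ 2 + x1 ^+ 2 + y1 ^+ 2 = 1,
    a0 = N%:C * (x0%:C + 'i * y0%:C) & a1 = N%:C * (x1%:C + 'i * y1%:C)].
Proof.
move=> nz; pose S := complex.Re a0 ^+ 2 + complex.Im a0 ^+ 2
                    + complex.Re a1 ^+ 2 + complex.Im a1 ^+ 2.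
have Spos : S > 0.
  apply: sum_sqr4_gt0; move: nz; rewrite !eq_complex -negb_and -andbA; apply: contraNN.
  by case/and4P => /eqP-> /eqP-> /eqP-> /eqP->; rewrite !eqxx.
pose N := Num.sqrt S.
have N0 : N != 0 by rewrite gt_eqF // sqrtr_gt0.
have polar (z : K) : z = N%:C * ((complex.Re z / N)%:C + 'i * (complex.Im z / N)%:C).
  have e (x : R) : N%:C * (x / N)%:C = x%:C by rewrite -rmorphM mulrCA divff ?mulr1.
  by rewrite mulrDr mulrCA !e -complexE.
exists N, (complex.Re a0 / N), (complex.Im a0 / N), (complex.Re a1 / N),
  (complex.Im a1 / N); split=> //.
by rewrite !expr_div_n -!mulrDl sqr_sqrtr ?ltW // divff // gt_eqF.
Qed.

(** The equation for all [j] says [J G = i G] for the complex gradient [G], that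
    is, [F] is holomorphic or antiholomorphic for [J]. *)
Lemma orthogonal_structure (F : mpoly 4 K) (d : nat) :
  F \is mpoly.ishomog1 d (@mpoly.mdeg 4) -> (d != 0)%N ->
  \sum_i mderiv i F ^+ 2 = 0 -> \sum_i mderiv i (mderiv i F) = 0 ->
  exists J : 'M[R]_4, [/\ J^T = - J, J *m J = - 1%:M
    & forall j, cder (fun i => (J j i)%:C) F = II * mderiv j F].
Proof.
move=> homF d0 null harm.
have eul : \sum_i var i * mderiv i F = (d%:R : K)%:MP * F.
  by rewrite (mpoly_euler homF) mpoly.mpolyC_nat.
have dK : (d%:R : K) != 0 by rewrite pnatr_eq0.
have nh : null_harmonic F va vb vc ve.
  split; rewrite !cder_pair_vector !mpoly.mpolyCN mpoly.mpolyC1.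
    by rewrite (pair_null sqr_II) -null sum_ord4.
  have c1 : (-1 * II : mpoly 4 K) = (- 'i)%:MP by rewrite mulN1r mpoly.mpolyCN.
  rewrite !mpoly.mderivD c1 !mpoly.mderiv_mulC -c1.
  rewrite [mderiv i1 (mderiv i0 F)]mpoly.mderiv_comm.
  rewrite [mderiv i3 (mderiv i2 F)]mpoly.mderiv_comm.
  by rewrite (pair_harm sqr_II) -harm sum_ord4.
have [s [hs [a0 [a1 [nz e1 e2]]]]] : exists s : R, s * s = 1 /\
    null_plane F va vb (pair_vector (- s%:C) i2 i3) (pair_vector s%:C i2 i3).
  have [h|h] := gradient_in_null_plane eul dK pair_frame nh.
    by exists 1; rewrite mulr1 rmorph1.
  by exists (-1); rewrite mulrNN mulr1 rmorphN rmorph1 opprK.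
have [N [x0 [y0 [x1 [y1 [N0 hn ha0 ha1]]]]]] := unit_pair nz.
have sC : s%:C%:MP * s%:C%:MP = 1 :> mpoly 4 K.
  by rewrite -mpoly.mpolyCM -rmorphM hs !rmorph1.
pose X (r : R) : mpoly 4 K := r%:C%:MP.
have XD x y : X (x + y) = X x + X y by rewrite /X !rmorphD.
have XN x : X (- x) = - X x by rewrite /X !rmorphN.
have XM x y : X (x * y) = X x * X y by rewrite /X !rmorphM.
have X0 : X 0 = 0 by rewrite /X !rmorph0.
have X1 : X 1 = 1 by rewrite /X !rmorph1.
have X2 : X 2 = 2 by rewrite -[2]/(1 + 1) XD X1.
have XX x : X (x ^+ 2) = X x ^+ 2 by rewrite !expr2 XM.
have NX : X N != 0 by rewrite /X mpoly.mpolyC_eq0 fmorph_eq0.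
have Ea x y : (N%:C * (x%:C + 'i * y%:C))%:MP = X N * (X x + II * X y).
  by rewrite mpoly.mpolyCM mpoly.mpolyCD mpoly.mpolyCM.
have hnX : X x0 ^+ 2 + X y0 ^+ 2 + X x1 ^+ 2 + X y1 ^+ 2 = 1.
  by rewrite -!XX -!XD hn.
have c1 : 1%:MP * II = II by rewrite mpoly.mpolyC1 mul1r.
have c2 : (-1)%:MP * II = - II by rewrite mpoly.mpolyCN mulNr c1.
have c3 : s%:C%:MP * II = II * X s by rewrite mulrC.
have c4 : (- s%:C)%:MP * II = - (II * X s) by rewrite mpoly.mpolyCN mulNr c3.
rewrite ha0 ha1 !Ea !cder_pair_vector c1 c4 -!mulrA in e1.
rewrite ha0 ha1 !Ea !cder_pair_vector c2 c3 -!mulrA -mulrN in e2.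
have {e1} := mulfI NX e1.
rewrite !mulNr => e1.
have {e2} := mulfI NX e2.
rewrite mulNr mulrA => e2.
have [h0 h1 h2 h3] := hopf_relations sqr_II sC hnX e1 e2.
pose k := x0 ^+ 2 + y0 ^+ 2 - x1 ^+ 2 - y1 ^+ 2.
pose al := 2 * (y0 * x1 - x0 * y1); pose be := 2 * (x0 * x1 + y0 * y1).
exists (hopf_matrix k al be s); split.
- exact: hopf_matrixT.
- apply: hopf_matrix_sqr => //; rewrite -(expr1n _ 2) -hn /k /al /be; ring.
- have Xk : X k = X x0 ^+ 2 + X y0 ^+ 2 - X x1 ^+ 2 - X y1 ^+ 2.
    by rewrite /k !XD !XN !XX.
  have Xal : X al = 2 * (X y0 * X x1 - X x0 * X y1).
    by rewrite /al XM X2 XD XN !XM.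
  have Xbe : X be = 2 * (X x0 * X x1 + X y0 * X y1).
    by rewrite /be XM X2 XD !XM.
  have z0 i : 0%:C%:MP * mderiv i F = 0 by rewrite -/(X 0) X0 mul0r.
  rewrite -/(X s) -Xk -Xal -Xbe in h0 h1 h2 h3.
  have X'N r : (- r)%:C%:MP = - X r by exact: XN.
  have X'M : (s * k)%:C%:MP = X s * X k /\ (s * al)%:C%:MP = X s * X al
    /\ (s * be)%:C%:MP = X s * X be by split; [|split]; exact: XM.
  have [m1 [m2 m3]] := X'M.
  move=> j; rewrite /cder sum_ord4 !mxE; elim/ord4_ind: j => /=; rewrite z0 ?X'N.
  + by rewrite m3 -h0 add0r [- X al * _]mulNr.
  + by rewrite m2 -h1 addr0.
  + by rewrite -h2 addr0 (XM s k) [- X be * _]mulNr [- (_ * _) * _]mulNr.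
  + by rewrite -h3 addr0 m1 (XM s be) (XM s al) [- (_ * X al) * _]mulNr.
Qed.
End Structure.

(** * Polynomial functions on R^4 *)

Section Transfer.
Variable R : realType.
Local Notation K := R[i].
Implicit Types (F G : mpoly 4 K) (x v : 'rV[R]_4).

Lemma pevalD F G x : peval (F + G) x = peval F x + peval G x.
Proof. exact: mpoly.mevalD. Qed.

Lemma pevalM F G x : peval (F * G) x = peval F x * peval G x.
Proof. exact: mpoly.mevalM. Qed.

Lemma pevalC c x : peval c%:MP x = c.
Proof. exact: mpoly.mevalC. Qed.

Lemma peval_sum (I : finType) (E : I -> mpoly 4 K) x :
  peval (\sum_i E i) x = \sum_i peval (E i) x.
Proof. exact: raddf_sum. Qed.

Lemma peval_var i x : peval (var i) x = (x 0 i)%:C.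
Proof. exact: mpoly.mevalXU. Qed.

Lemma complex_ReM (z w : K) :
  complex.Re (z * w) = complex.Re z * complex.Re w - complex.Im z * complex.Im w.
Proof. by case: z => a b; case: w. Qed.

Lemma complex_ImM (z w : K) :
  complex.Im (z * w) = complex.Re z * complex.Im w + complex.Im z * complex.Re w.
Proof. by case: z => a b; case: w. Qed.

Lemma complex_ReD (z w : K) : complex.Re (z + w) = complex.Re z + complex.Re w.
Proof. by case: z => a b; case: w. Qed.

Lemma complex_ImD (z w : K) : complex.Im (z + w) = complex.Im z + complex.Im w.
Proof. by case: z => a b; case: w. Qed.

Lemma differentiable_peval F x :
  differentiable (re_part (peval F)) x /\ differentiable (im_part (peval F)) x.
Proof.
elim/mpoly_ring_ind: F x => [c|i|F G hF hG|F G hF hG] x.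
- have -> : re_part (peval c%:MP) = cst (complex.Re c).
    by apply/funext => y; rewrite /re_part pevalC.
  have -> : im_part (peval c%:MP) = cst (complex.Im c).
    by apply/funext => y; rewrite /im_part pevalC.
  by split; apply: differentiable_cst.
- have -> : re_part (peval (var i)) = (fun y : 'rV[R]_4 => y 0 i).
    by apply/funext => y; rewrite /re_part peval_var.
  have -> : im_part (peval (var i)) = cst (0 : R).
    by apply/funext => y; rewrite /im_part peval_var.
  by split; [apply: differentiable_coord | apply: differentiable_cst].
- have -> : re_part (peval (F + G)) = re_part (peval F) + re_part (peval G).
    by apply/funext => y; rewrite /re_part pevalD complex_ReD.
  have -> : im_part (peval (F + G)) = im_part (peval F) + im_part (peval G).
    by apply/funext => y; rewrite /im_part pevalD complex_ImD.
  by have [? ?] := hF x; have [? ?] := hG x; split; apply: differentiableD.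
- have -> : re_part (peval (F * G)) = re_part (peval F) * re_part (peval G)
                                     - im_part (peval F) * im_part (peval G).
    by apply/funext => y; rewrite /re_part pevalM complex_ReM.
  have -> : im_part (peval (F * G)) = re_part (peval F) * im_part (peval G)
                                     + im_part (peval F) * re_part (peval G).
    by apply/funext => y; rewrite /im_part pevalM complex_ImM.
  have [? ?] := hF x; have [? ?] := hG x.
  by split; [apply: differentiableB | apply: differentiableD]; apply: differentiableM.
Qed.

Lemma derive_coord (i : 'I_4) x v : 'D_v (fun y : 'rV[R]_4 => y 0 i) x = v 0 i.
Proof.
apply: cvg_lim => //=.
apply: (@cvg_trans _ (cst (v 0 i) @ 0^')); last exact: cvg_cst.
apply: near_eq_cvg; near=> h => /=.
have h0 : h != 0 by near: h; exact: nbhs_dnbhs_neq.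
by rewrite !mxE addrK [_ *: _]mulrA mulVf ?mul1r.
Unshelve. all: by end_near. Qed.

Lemma partial_peval F i x :
  partial i (re_part (peval F)) x = complex.Re (peval (mderiv i F) x) /\
  partial i (im_part (peval F)) x = complex.Im (peval (mderiv i F) x).
Proof.
rewrite /partial.
elim/mpoly_ring_ind: F =>
  [c|j|F G [hF1 hF2] [hG1 hG2]|F G [hF1 hF2] [hG1 hG2]].
- have -> : re_part (peval c%:MP) = cst (complex.Re c).
    by apply/funext => y; rewrite /re_part pevalC.
  have -> : im_part (peval c%:MP) = cst (complex.Im c).
    by apply/funext => y; rewrite /im_part pevalC.
  by rewrite !derive_cst mpoly.mderivC -mpoly.mpolyC0 pevalC.
- have -> : re_part (peval (var j)) = (fun y : 'rV[R]_4 => y 0 j).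
    by apply/funext => y; rewrite /re_part peval_var.
  have -> : im_part (peval (var j)) = cst (0 : R).
    by apply/funext => y; rewrite /im_part peval_var.
  rewrite derive_coord derive_cst mderiv_var pevalC mxE eqxx.
  by rewrite eq_sym; case: (_ == _).
- have -> : re_part (peval (F + G)) = re_part (peval F) + re_part (peval G).
    by apply/funext => y; rewrite /re_part pevalD complex_ReD.
  have -> : im_part (peval (F + G)) = im_part (peval F) + im_part (peval G).
    by apply/funext => y; rewrite /im_part pevalD complex_ImD.
  have [? ?] := differentiable_peval F x; have [? ?] := differentiable_peval G x.
  rewrite mpoly.mderivD pevalD complex_ReD complex_ImD -hF1 -hF2 -hG1 -hG2.
  by split; apply: deriveD; apply: diff_derivable.
- have -> : re_part (peval (F * G)) = re_part (peval F) * re_part (peval G)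
                                     - im_part (peval F) * im_part (peval G).
    by apply/funext => y; rewrite /re_part pevalM complex_ReM.
  have -> : im_part (peval (F * G)) = re_part (peval F) * im_part (peval G)
                                     + im_part (peval F) * re_part (peval G).
    by apply/funext => y; rewrite /im_part pevalM complex_ImM.
  have [? ?] := differentiable_peval F x; have [? ?] := differentiable_peval G x.
  rewrite mpoly.mderivM pevalD !pevalM complex_ReD complex_ImD.
  rewrite !complex_ReM !complex_ImM -hF1 -hF2 -hG1 -hG2.
  rewrite deriveB ?deriveD ?deriveM;
    do ?[exact: diff_derivable | apply: derivableM; exact: diff_derivable].
  have E1 (a b c e a' b' c' e' : R) :
    a * c' + c * a' - (b * e' + e * b') = a' * c - b' * e + (a * c' - b * e') by ring.
  have E2 (a b c e a' b' c' e' : R) :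
    a * e' + e * a' + (b * c' + c * b') = a' * e + b' * c + (a * e' + b * c') by ring.
  by split; [exact: E1 | exact: E2].
Qed.
End Transfer.

Section Pointwise.
Variable R : realType.
Local Notation K := R[i].
Implicit Types (F G : mpoly 4 K) (x v : 'rV[R]_4) (al : K).

Lemma peval_eq0 F : (forall x, peval F x = 0) -> F = 0.
Proof.
move=> h; apply: mpoly_nat_zeros => x; rewrite -[RHS](h (\row_i (x i)%:R)).
by apply: mpoly.meval_eq => i; rewrite mxE rmorph_nat.
Qed.

Lemma cderiv_peval F i x : cderiv (peval F) x (e_ R i) = peval (mderiv i F) x.
Proof.
have [h1 h2] := partial_peval F i x.
by apply/eqP; rewrite eq_complex /= -h1 -h2 !eqxx.
Qed.

Lemma cgrad_peval F x i : cgrad (peval F) x 0 i = peval (mderiv i F) x.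
Proof. by rewrite mxE cderiv_peval. Qed.

Lemma tau_peval F x : tau (peval F) x = peval (\sum_i mderiv i (mderiv i F)) x.
Proof.
rewrite peval_sum; apply: eq_bigr => i _; rewrite -cderiv_peval.
by congr (cderiv _ x _); apply/funext => y; rewrite cgrad_peval.
Qed.

Lemma kappa_peval F x : kappa (peval F) (peval F) x = peval (\sum_i mderiv i F ^+ 2) x.
Proof.
by rewrite peval_sum; apply: eq_bigr => i _; rewrite !cgrad_peval -pevalM expr2.
Qed.

(** Identities between polynomial functions on R^4 are identities between
    polynomials. *)
Lemma eigenfunction_E4_poly F : eigenfunction_E4 0 0 (peval F) ->
  \sum_i mderiv i F ^+ 2 = 0 /\ \sum_i mderiv i (mderiv i F) = 0.
Proof.
case=> _ ht hk; split; apply: peval_eq0 => x.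
  by rewrite -kappa_peval hk mul0r.
by rewrite -tau_peval ht mul0r.
Qed.

(** The surface f^-1(l_alpha) is where the conjugate of alpha times [f] is
    purely imaginary. *)
Lemma P_conjE F al x : P_ F al x = complex.Re (conjc al * peval F x).
Proof. by rewrite complex_ReM /P_; case: al => a b /=; rewrite mulNr opprK. Qed.

Lemma P_sum (I : finType) (E : I -> mpoly 4 K) al x :
  P_ (\sum_i E i) al x = \sum_i P_ (E i) al x.
Proof.
rewrite P_conjE peval_sum mulr_sumr; under [RHS]eq_bigr do rewrite P_conjE.
by apply: (big_morph (@complex.Re R)) => // z w; rewrite complex_ReD.
Qed.

Lemma P_0 al x : P_ 0 al x = 0.
Proof. by rewrite /P_ -mpoly.mpolyC0 pevalC !mulr0 addr0. Qed.

Lemma P_real_factor F G (r : R) al x y :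
  peval F x = r%:C * peval G y -> P_ F al x = r * P_ G al y.
Proof.
move=> E; rewrite /P_ E complex_ReM complex_ImM /= !mul0r subr0 addr0.
by rewrite mulrDr !(mulrCA r).
Qed.

Lemma P_real_mul F (r : R) al x : P_ (r%:C%:MP * F) al x = r * P_ F al x.
Proof. by apply: P_real_factor; rewrite pevalM pevalC. Qed.

Lemma P_var_mul F i al x : P_ (var i * F) al x = x 0 i * P_ F al x.
Proof. by apply: P_real_factor; rewrite pevalM peval_var. Qed.

Lemma P_linear F al : P_ F al = complex.Re al *: re_part (peval F)
                             + complex.Im al *: im_part (peval F).
Proof. by apply/funext. Qed.

Lemma differentiable_P F al x : differentiable (P_ F al) x.
Proof.
rewrite P_linear; have [? ?] := differentiable_peval F x.
by apply: differentiableD; apply: differentiableZ.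
Qed.

Lemma partial_P F al i : partial i (P_ F al) = P_ (mderiv i F) al.
Proof.
apply/funext => x; have [h1 h2] := partial_peval F i x.
have [? ?] := differentiable_peval F x.
rewrite /partial P_linear deriveD ?deriveZ; do ?exact: diff_derivable;
  try by apply: derivableZ; exact: diff_derivable.
by rewrite -/(partial i _ x) -/(partial i _ x) h1 h2.
Qed.

Lemma grad_P F al x i : grad (P_ F al) x 0 i = P_ (mderiv i F) al x.
Proof. by rewrite mxE partial_P. Qed.

Lemma Hess_P F al x v w : Hess (P_ F al) x v w =
  \sum_(i < 4) \sum_(j < 4) P_ (mderiv i (mderiv j F)) al x * v 0 i * w 0 j.
Proof. by apply: eq_bigr => i _; apply: eq_bigr => j _; rewrite !partial_P. Qed.

Lemma euler_P F (d : R) al x :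
  \sum_i var i * mderiv i F = d%:C%:MP * F ->
  \sum_i x 0 i * P_ (mderiv i F) al x = d * P_ F al x.
Proof.
move=> h; rewrite -P_real_mul -h P_sum.
by apply: eq_bigr => i _; rewrite P_var_mul.
Qed.

Lemma euler_mderiv F (k : R) i :
  \sum_j var j * mderiv j F = k%:C%:MP * F ->
  \sum_j var j * mderiv j (mderiv i F) = (k - 1)%:C%:MP * mderiv i F.
Proof.
move=> h; rewrite -cder_delta.
have -> : (k - 1)%:C = k%:C - 1 :> K by rewrite rmorphB rmorph1.
exact: euler_cder.
Qed.

Lemma meval_scale F d (w : K) (z : 'I_4 -> K) :
  F \is mpoly.ishomog1 d (@mpoly.mdeg 4) ->
  meval (fun i => w * z i) F = w ^+ d * meval z F.
Proof.
move/mpoly.dhomogP => hF; rewrite !mpoly.mevalE mulr_sumr.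
apply: eq_big_seq => m /hF <-; rewrite mulrCA; congr (_ * _).
rewrite /= mpoly.mdegE expr_sum -big_split /=.
by apply: eq_bigr => i _; rewrite exprMn.
Qed.

Lemma peval_scale F d (t : R) x : F \is mpoly.ishomog1 d (@mpoly.mdeg 4) ->
  peval F (t *: x) = (t ^+ d)%:C * peval F x.
Proof.
move=> hF; rewrite rmorphXn -(meval_scale _ _ hF).
by apply: mpoly.meval_eq => i; rewrite mxE rmorphM.
Qed.

Lemma P_scale F d al (t : R) x : F \is mpoly.ishomog1 d (@mpoly.mdeg 4) ->
  P_ F al (t *: x) = t ^+ d * P_ F al x.
Proof. by move=> hF; apply: P_real_factor; exact: peval_scale. Qed.

Definition rotation (J : 'M[R]_4) (c s : R) : 'M[R]_4 := c%:M + s *: J.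

(** The matrix [c + s J] is orthogonal because [J] is skew with square [-1]. *)
Lemma rotation_tr J c s : J^T = - J -> J *m J = - 1%:M -> c ^+ 2 + s ^+ 2 = 1 ->
  rotation J c s *m (rotation J c s)^T = 1%:M.
Proof.
move=> hT h2 hcs; rewrite /rotation linearD /= tr_scalar_mx linearZ /= hT.
rewrite scalerN mulmxBr !mulmxDl !mul_scalar_mx mul_mx_scalar.
rewrite -!scalemxAl -!scalemxAr h2 !scalerA opprD addrA addrK.
by rewrite scalerN opprK -[c%:M]scalemx1 scalerA -scalerDl -!expr2 hcs scale1r.
Qed.

(** Up to the scalar [c + i s], the rotation moves [x] by a multiple of
    [J x - i x].  This complex vector is orthogonal to the gradient of [F], so
    it is a direction along which [F] is constant; what remains is
    homogeneity. *)
Lemma peval_rotation F d (J : 'M[R]_4) (c s : R) x :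
  F \is mpoly.ishomog1 d (@mpoly.mdeg 4) ->
  (forall j, cder (fun i => (J j i)%:C) F = (0 +i* 1 : K)%:MP * mderiv j F) ->
  peval F (x *m rotation J c s) = (c +i* s) ^+ d * peval F x.
Proof.
move=> hF hJ; rewrite -(meval_scale _ _ hF).
(* The vector [s (J x - i x)]. *)
pose n i : K := \sum_j (s * x 0 j)%:C * ((J j i)%:C - 'i * (j == i)%:R).
have n0 : cder n F = 0.
  rewrite /cder /n.
  transitivity (\sum_j ((s * x 0 j)%:C)%:MP *
    (cder (fun i => (J j i)%:C) F - (0 +i* 1 : K)%:MP * mderiv j F)).
    rewrite /cder; under eq_bigr do rewrite rmorph_sum mulr_suml.
    rewrite exchange_big; apply: eq_bigr => j _ /=.
    rewrite mulrBr mulr_sumr.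
    have -> : mderiv j F = \sum_i ((j == i)%:R : K)%:MP * mderiv i F.
      rewrite (bigD1 j) //= eqxx mpoly.mpolyC1 mul1r big1 ?addr0 // => i /negbTE ij.
      by rewrite eq_sym ij mpoly.mpolyC0 mul0r.
    rewrite !mulr_sumr -sumrB; apply: eq_bigr => i _.
    rewrite mpoly.mpolyCM mpoly.mpolyCB mpoly.mpolyCM.
    by rewrite -mulrA mulrBl mulrBr !mulrA.
  by apply: big1 => j _; rewrite hJ subrr mulr0.
rewrite -(cder_eq0_translate _ n0); apply: mpoly.meval_eq => i.
rewrite /n /rotation mulmxDr mul_mx_scalar -scalemxAr !mxE.
rewrite rmorphD rmorphM /= rmorphM rmorph_sum /=.
under [in RHS]eq_bigr do rewrite mulrBr.
rewrite sumrB [in X in _ = _ + (_ - X)](bigD1 i) //= eqxx mulr1.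
rewrite [X in _ = _ + (_ - (_ + X))]big1 => [|j /negbTE ->]; last by rewrite !mulr0.
rewrite addr0 rmorphM.
under [in RHS]eq_bigr do rewrite rmorphM -mulrA -rmorphM.
rewrite -mulr_sumr.
have -> : c +i* s = c%:C + 'i * s%:C.
  apply/eqP; rewrite eq_complex /=.
  by rewrite !(mul0r, mul1r, mulr0, subr0, addr0, add0r) !eqxx.
ring.
Qed.

End Pointwise.

(** * Rotations that multiply F by a unit complex number *)

Section Rotations.
Variable R : realType.
Local Notation K := R[i].
Implicit Types (F G : mpoly 4 K) (x u v : 'rV[R]_4) (al be z : K).

Lemma norm1_Re_Im z : `|z| = 1 -> complex.Re z ^+ 2 + complex.Im z ^+ 2 = 1.
Proof.
by move=> z1; apply: (@complexI R); rewrite add_Re2_Im2 z1 expr1n.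
Qed.

Lemma conjc_mul_norm1 z : `|z| = 1 -> conjc z * z = 1.
Proof.
move=> /norm1_Re_Im; case: z => a b /= h.
apply/eqP; rewrite eq_complex /= mulNr opprK -!expr2 h.
by rewrite mulrC mulNr subrr !eqxx.
Qed.

Lemma norm_conjc z : `|conjc z| = `|z|.
Proof. by rewrite !normc_def; case: z => a b /=; rewrite sqrrN. Qed.

(** The angle of the rotation is that of a [d]-th root of [z]. *)
Lemma peval_equivariance F d z : F \is mpoly.ishomog1 d (@mpoly.mdeg 4) ->
  (d != 0)%N -> \sum_i mderiv i F ^+ 2 = 0 -> \sum_i mderiv i (mderiv i F) = 0 ->
  `|z| = 1 ->
  exists M : 'M[R]_4, M *m M^T = 1%:M /\ forall x, peval F (x *m M) = z * peval F x.
Proof.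
move=> hF d0 null harm z1.
have [J [JT J2 hJ]] := orthogonal_structure hF d0 null harm.
have dpos : (0 < d)%N by rewrite lt0n.
pose w := d.-root z; have wd : w ^+ d = z by rewrite rootCK.
have w1 : `|w| = 1.
  by apply/eqP; rewrite -(@pexpr_eq1 _ _ d) // -normrX wd z1.
exists (rotation J (complex.Re w) (complex.Im w)); split.
  by apply: rotation_tr => //; apply: norm1_Re_Im.
move=> x; rewrite (peval_rotation _ _ _ hF hJ); congr (_ * _).
by rewrite -wd; case: (w).
Qed.

Lemma dotE u v : dot u v = (u *m v^T) 0 0.
Proof. by rewrite mxE; apply: eq_bigr => i _; rewrite mxE. Qed.

Lemma dot_orthogonal (M : 'M[R]_4) u v : M *m M^T = 1%:M ->
  dot (u *m M) (v *m M) = dot u v.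
Proof.
by move=> hM; rewrite !dotE trmx_mul mulmxA -(mulmxA u) hM mulmx1.
Qed.

Lemma isometry_orthogonal (M : 'M[R]_4) (A B : set 'rV[R]_4) :
  M *m M^T = 1%:M -> (forall x, A x <-> B (x *m M)) ->
  isometry_between A B (fun x => x *m M).
Proof.
move=> hM hAB; have hM' : M^T *m M = 1%:M by apply: mulmx1C.
split.
  split.
  - by move=> x /hAB.
  - move=> x y _ _ /(congr1 (mulmx^~ M^T)).
    by rewrite -!mulmxA hM !mulmx1.
  - move=> y By; exists (y *m M^T); last by rewrite -mulmxA hM' mulmx1.
    by apply/hAB; rewrite -mulmxA hM' mulmx1.
by move=> x y _ _; rewrite /enorm -mulmxBl dot_orthogonal.
Qed.

Lemma P_rotate F (M : 'M[R]_4) al be x : `|be| = 1 ->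
  (forall y, peval F (y *m M) = be * conjc al * peval F y) ->
  P_ F be (x *m M) = P_ F al x.
Proof.
by move=> b1 h; rewrite !P_conjE h mulrA mulrA conjc_mul_norm1 // mul1r.
Qed.

Lemma level_surfaceE (f : S3 R -> K) F al x :
  (forall p : S3 R, f p = peval F (val p)) ->
  (val @` (f @^-1` line al)) x <-> dot x x = 1 /\ P_ F al x = 0.
Proof.
move=> hf; split.
  by case=> p; rewrite /line /= hf => h <-; split; [apply/eqP/(valP p) | exact: h].
case=> /eqP hx hP; exists (exist _ x hx) => //=.
by rewrite /line /= hf.
Qed.

Lemma surface_isometry (f : S3 R -> K) F al be (M : 'M[R]_4) :
  (forall p : S3 R, f p = peval F (val p)) -> `|be| = 1 -> M *m M^T = 1%:M ->
  (forall y, peval F (y *m M) = be * conjc al * peval F y) ->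
  isometry_between setT setT (fun x => x *m M) /\
  isometry_between (val @` (f @^-1` line al)) (val @` (f @^-1` line be))
    (fun x => x *m M).
Proof.
move=> hf b1 hM hF; split; first exact: isometry_orthogonal.
apply: (isometry_orthogonal hM) => x.
by split=> /(level_surfaceE _ _ hf)[h1 h2]; apply/(level_surfaceE _ _ hf);
  move: h1 h2; rewrite (dot_orthogonal x x hM) (P_rotate x b1 hF).
Qed.

Lemma derive_mulmx (h : 'rV[R]_4 -> R) (M : 'M[R]_4) x v :
  'D_v (fun y => h (y *m M)) x = 'D_(v *m M) h (x *m M).
Proof.
rewrite /derive; congr (lim _).
apply: (congr1 (fun g : R -> R => g @ 0^')); apply/funext => t /=.
by rewrite mulmxDl -scalemxAl.
Qed.

End Rotations.

(** * Comparison of functions with the same zero set *)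

Section Calculus.
Variable R : realType.
Implicit Types (h k P phi : 'rV[R]_4 -> R) (x u v w n : 'rV[R]_4).

Lemma dotC u v : dot u v = dot v u.
Proof. by apply: eq_bigr => i _; rewrite mulrC. Qed.

Lemma dotDl u v w : dot (u + v) w = dot u w + dot v w.
Proof. by rewrite -big_split; apply: eq_bigr => i _; rewrite mxE mulrDl. Qed.

Lemma dotZl (a : R) u v : dot (a *: u) v = a * dot u v.
Proof. by rewrite mulr_sumr; apply: eq_bigr => i _; rewrite mxE mulrA. Qed.

Lemma dotNl u v : dot (- u) v = - dot u v.
Proof. by rewrite -scaleN1r dotZl mulN1r. Qed.

Lemma dotDr u v w : dot u (v + w) = dot u v + dot u w.
Proof. by rewrite dotC dotDl !(dotC u). Qed.

Lemma dotZr (a : R) u v : dot u (a *: v) = a * dot u v.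
Proof. by rewrite dotC dotZl (dotC u). Qed.

Lemma dotNr u v : dot u (- v) = - dot u v.
Proof. by rewrite dotC dotNl (dotC u). Qed.

Lemma dot_basis u i : dot u (e_ R i) = u 0 i.
Proof.
rewrite /dot (bigD1 i) //= big1 ?addr0 => [|j /negbTE ji]; last first.
  by rewrite /e_ mxE ji andbF mulr0.
by rewrite /e_ mxE !eqxx mulr1.
Qed.

Lemma dot_ge0 u : 0 <= dot u u.
Proof. by apply: sumr_ge0 => i _; rewrite -expr2 sqr_ge0. Qed.

Lemma dot_eq0 u : (dot u u == 0) = (u == 0).
Proof.
apply/idP/eqP => [|->]; last first.
  by rewrite /dot big1 // => i _; rewrite mxE mul0r.
rewrite psumr_eq0 => [/allP h|i _]; last by rewrite -expr2 sqr_ge0.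
apply/rowP => i; rewrite mxE; apply/eqP; rewrite -sqrf_eq0 expr2.
by apply: h; rewrite mem_index_enum.
Qed.

Lemma dot_gt0 u : u != 0 -> 0 < dot u u.
Proof. by move=> u0; rewrite lt_def dot_ge0 dot_eq0 u0. Qed.

Lemma row_sum_basis u : u = \sum_i u 0 i *: e_ R i.
Proof. exact: row_sum_delta. Qed.

Lemma derive_grad h x v : differentiable h x -> 'D_v h x = dot (grad h x) v.
Proof.
move=> dh; rewrite deriveE // {1}[v]row_sum_basis linear_sum.
apply: eq_bigr => i _; rewrite linearZ /= mxE /partial deriveE //.
by rewrite mulrC.
Qed.

Definition twice_differentiable h x :=
  (\forall y \near x, differentiable h y) /\ forall i, differentiable (partial i h) x.

Lemma dot_gradE h w :
  (fun y => dot (grad h y) w) = \sum_(i < 4) (w 0 i *: partial i h).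
Proof.
apply/funext => y; rewrite fct_sumE; apply: eq_bigr => i _.
by rewrite mxE mulrC.
Qed.

Lemma differentiable_dot_grad h x w : (forall i, differentiable (partial i h) x) ->
  differentiable (fun y => dot (grad h y) w) x.
Proof.
move=> dh; rewrite dot_gradE.
by apply: differentiable_sum => i; apply: differentiableZ.
Qed.

Lemma derive_dot_grad h x v w : (forall i, differentiable (partial i h) x) ->
  'D_v (fun y => dot (grad h y) w) x = Hess h x v w.
Proof.
move=> dh; rewrite dot_gradE.
rewrite derive_sum => [|i]; last by apply: derivableZ; apply: diff_derivable.
rewrite /Hess exchange_big; apply: eq_bigr => j _.
rewrite deriveZ; last exact: diff_derivable.
rewrite derive_grad // /dot scaler_sumr; apply: eq_bigr => i _.
by rewrite mxE [_ *: _]mulrC.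
Qed.

Lemma diff_approx h x (e : R) : differentiable h x -> 0 < e ->
  \forall u \near nbhs (0 : 'rV[R]_4), `|h (u + x) - h x - 'D_u h x| <= e * `|u|.
Proof.
move=> dh e0; have /eqaddoP := diff_locally dh.
move=> /(_ e e0); apply: filterS => u /=.
by rewrite deriveE // /= !fctE /= opprD addrA.
Qed.

(** From [x + t v] a zero of [P] is reached by a correction along [n] of size at
    most [|t|], by the intermediate value theorem.  Subtracting from [phi] a
    multiple of [P] that kills its derivative along [n] makes this correction
    invisible to first order; the difference vanishes at the zeros so found,
    so its derivative along [v], which is that of [phi], must vanish. *)
Lemma derive_tangent_eq0 P phi x v n : P x = 0 ->
  (\forall y \near x, differentiable P y) -> differentiable phi x ->
  (\forall y \near x, P y = 0 -> phi y = 0) ->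
  'D_n P x != 0 -> 'D_v P x = 0 -> 'D_v phi x = 0.
Proof.
move=> P0 dP dphi van Dn0 Dv0; have dPx := nbhs_singleton dP.
pose k := 'D_n phi x / 'D_n P x; pose psi := phi - k *: P.
have dpsi : differentiable psi x.
  by apply: differentiableB => //; apply: differentiableZ.
have psiD u : 'D_u psi x = 'D_u phi x - k * 'D_u P x.
  rewrite deriveB ?deriveZ //; try exact: diff_derivable.
  by apply: derivableZ; exact: diff_derivable.
have psi_v : 'D_v psi x = 'D_v phi x by rewrite psiD Dv0 mulr0 subr0.
have psi_n : 'D_n psi x = 0 by rewrite psiD /k divfK ?subrr.
have psi0 : psi x = 0.
  by rewrite /psi !fctE P0 (nbhs_singleton van) ?scaler0 ?subrr.
rewrite -psi_v; apply/eqP; apply: contraT => dv0.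
set c := 'D_n P x in Dn0; set d := 'D_v psi x in dv0.
pose B := `|v| + `|n| + 1.
have B0 : 0 < B by rewrite ltr_pwDr ?addr_ge0.
(* With this precision both [P] at the end points [t v - t n] and [t v + t n]
   and [psi] in between keep the sign of their linear part. *)
pose e := Num.min `|c| `|d| / (2 * B).
have e0 : 0 < e by rewrite divr_gt0 ?mulr_gt0 // lt_min !normr_gt0 Dn0.
have : \forall u \near nbhs (0 : 'rV[R]_4),
  [/\ `|P (u + x) - P x - 'D_u P x| <= e * `|u|,
      `|psi (u + x) - psi x - 'D_u psi x| <= e * `|u|,
      differentiable P (u + x) & P (u + x) = 0 -> phi (u + x) = 0].
  have h1 := diff_approx dPx e0; have h2 := diff_approx dpsi e0.
  have h3 : \forall u \near nbhs (0 : 'rV[R]_4), differentiable P (u + x).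
    by move: dP; rewrite (near_shift 0 x); apply: filterS => u /=; rewrite subr0.
  have h4 : \forall u \near nbhs (0 : 'rV[R]_4), P (u + x) = 0 -> phi (u + x) = 0.
    by move: van; rewrite (near_shift 0 x); apply: filterS => u /=; rewrite subr0.
  by near=> u; split; near: u.
move=> /nbhs_ballP[r /= r0 hr].
have [t [t0 tB]] : exists t, 0 < t /\ t * B = r / 2.
  exists (r / (2 * B)); split; first by rewrite divr_gt0 ?mulr_gt0.
  by field; rewrite gt_eqF.
pose u s := t *: v + s *: n.
have ub s : `|s| <= t -> `|u s| <= t * B.
  move=> st; apply: le_trans (ler_normD _ _) _; rewrite !normrZ (gtr0_norm t0).
  rewrite /B !mulrDr mulr1; have := ler_wpM2r (normr_ge0 n) st.
  lra.
have near_u s : `|s| <= t -> [/\ `|P (u s + x) - P x - 'D_(u s) P x| <= e * `|u s|,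
      `|psi (u s + x) - psi x - 'D_(u s) psi x| <= e * `|u s|,
      differentiable P (u s + x) & P (u s + x) = 0 -> phi (u s + x) = 0].
  move=> st; apply: hr; rewrite -ball_normE /= sub0r normrN.
  by apply: le_lt_trans (ub s st) _; rewrite tB; lra.
have Du h s : differentiable h x -> 'D_(u s) h x = t * 'D_v h x + s * 'D_n h x.
  by move=> dh; rewrite !derive_grad // /u dotDr !dotZr.
have eB s : `|s| <= t -> e * `|u s| <= t * Num.min `|c| `|d| / 2.
  move=> st; apply: le_trans (ler_wpM2l (ltW e0) (ub s st)) _.
  by rewrite /e le_eqVlt; apply/orP; left; apply/eqP; field; rewrite gt_eqF.
have mc : Num.min `|c| `|d| <= `|c| by rewrite ge_min lexx.
have md : Num.min `|c| `|d| <= `|d| by rewrite ge_min lexx orbT.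
have tm : t * Num.min `|c| `|d| <= t * `|c| by rewrite ler_pM2l.
have tm' : t * Num.min `|c| `|d| <= t * `|d| by rewrite ler_pM2l.
have tc : 0 < t * `|c| by rewrite mulr_gt0 ?normr_gt0.
have td : 0 < t * `|d| by rewrite mulr_gt0 ?normr_gt0.
pose g s := P (u s + x).
have g_end s : `|s| = t -> `|g s - s * c| < t * `|c|.
  move=> st; have st' : `|s| <= t by rewrite st.
  have [+ _ _ _] := near_u s st'; rewrite P0 subr0 Du // Dv0 mulr0 add0r => h.
  apply: le_lt_trans h _; apply: le_lt_trans (eB s st') _; lra.
have [s st gs] : exists2 s, s \in `[- t, t] & g s = 0.
  apply: IVT; first lra.
    apply: continuous_in_subspaceT => s; rewrite inE /= in_itv /= -ler_norml => st.
    have [_ _ dPs _] := near_u s st.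
    apply: (@continuous_comp _ _ _ (fun s => u s + x) P).
      apply: differentiable_continuous.
      apply: differentiableD => //; apply: differentiableD => //.
    exact: differentiable_continuous.
  have := g_end t (gtr0_norm t0); have := g_end (- t).
  rewrite normrN => /(_ (gtr0_norm t0)).
  rewrite !ltr_norml.
  have [c0|c0] := ltP 0 c.
    rewrite (gtr0_norm c0) => /andP[h1 h2] /andP[h3 h4].
    by rewrite ge_min le_max; apply/andP; split; apply/orP; [left|right]; lra.
  rewrite (ler0_norm c0) => /andP[h1 h2] /andP[h3 h4].
  by rewrite ge_min le_max; apply/andP; split; apply/orP; [right|left]; lra.
have st' : `|s| <= t by rewrite ler_norml; move: st; rewrite in_itv.
have [_ h _ /(_ gs) phi0] := near_u s st'.
have psis : psi (u s + x) = 0 by rewrite /psi !fctE phi0 -/(g s) gs scaler0 subrr.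
move: h; rewrite psis psi0 subr0 sub0r normrN Du // psi_n mulr0 addr0.
rewrite normrM (gtr0_norm t0).
move=> /le_trans /(_ (eB s st')); rewrite -/d => h; exfalso; lra.
Unshelve. all: by end_near. Qed.

(** The first-order statement is [derive_tangent_eq0].  It holds at all zeros
    of [P] near [x], so for a fixed [v] the function
    [L y = D_v k * D_n P - D_n k * D_v P] vanishes on the zero set of [P] as
    well; [derive_tangent_eq0] applied to [L] is the second-order statement. *)
Lemma level_set_comparison P k x : P x = 0 ->
  twice_differentiable P x -> twice_differentiable k x ->
  (\forall y \near x, P y = 0 -> k y = 0) -> grad P x != 0 ->
  exists l : R, grad k x = l *: grad P x /\
    forall v, dot (grad P x) v = 0 -> Hess k x v v = l * Hess P x v v.
Proof.
move=> P0 [dP ddP] [dk ddk] van gP0.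
set n := grad P x in gP0 *; pose c := dot n n.
have c0 : c != 0 by rewrite dot_eq0.
have dPx := nbhs_singleton dP; have dkx := nbhs_singleton dk.
have tangent y v m : P y = 0 -> (\forall z \near y, differentiable P z) ->
    (\forall z \near y, P z = 0 -> k z = 0) -> differentiable k y ->
    dot (grad P y) m != 0 -> dot (grad P y) v = 0 -> dot (grad k y) v = 0.
  move=> Py dPy vany dky m0 v0; have dPy' := nbhs_singleton dPy.
  rewrite -derive_grad //; apply: (derive_tangent_eq0 Py dPy dky vany (n := m)).
    by rewrite derive_grad.
  by rewrite derive_grad.
pose l := dot (grad k x) n / c.
have gk : grad k x = l *: n.
  apply/rowP => i; rewrite [RHS]mxE -!dot_basis.
  (* The vector is [c] times the tangential part of [e_i]. *)
  have : dot (grad k x) (c *: e_ R i - dot n (e_ R i) *: n) = 0.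
    apply: (tangent _ _ n) => //; rewrite -/n dotDr dotNr !dotZr -/c; ring.
  rewrite dotDr dotNr !dotZr => /eqP; rewrite subr_eq0 => /eqP E.
  by apply: (mulfI c0); rewrite E /l; field.
exists l; split=> // v nv.
pose L y := dot (grad k y) v * dot (grad P y) n - dot (grad k y) n * dot (grad P y) v.
have dL : differentiable L x.
  by apply: differentiableB; apply: differentiableM; apply: differentiable_dot_grad.
have DL : 'D_v L x = c * (Hess k x v v - l * Hess P x v v).
  have D h w : (forall i, differentiable (partial i h) x) ->
     derivable (fun y => dot (grad h y) w) x v.
    by move=> dh; apply/diff_derivable/differentiable_dot_grad.
  rewrite deriveB; try (apply: derivableM; exact: D).
  rewrite !deriveM; try exact: D.
  rewrite (derive_dot_grad v v ddk) (derive_dot_grad v v ddP).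
  rewrite (derive_dot_grad v n ddk) (derive_dot_grad v n ddP).
  have -> : dot (grad k x) v = 0 by rewrite gk dotZl nv mulr0.
  have -> : dot (grad k x) n = l * c by rewrite gk dotZl.
  rewrite -/n nv -/c.
  have E (a b e f : R) : 0 * a + c * b - (l * c * e + 0 * f) = c * (b - l * e) by ring.
  exact: E.
have : 'D_v L x = 0.
  apply: (derive_tangent_eq0 P0 dP dL _ (n := n)); rewrite ?derive_grad // -/n.
  have c1 : \forall y \near x, dot (grad P y) n != 0.
    have := differentiable_continuous (differentiable_dot_grad n ddP).
    by move/cvgr_neq0; apply.
  have dP' := near_join dP; have van' := near_join van.
  near=> y => Py.
  have m0 : dot (grad P y) n != 0 by near: y.
  have : dot (grad k y) (dot (grad P y) n *: v - dot (grad P y) v *: n) = 0.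
    apply: (tangent _ _ n) => //; first by near: y.
    - by near: y.
    - by near: y.
    - rewrite dotDr dotNr !dotZr; ring.
  by rewrite dotDr dotNr !dotZr /L => <-; ring.
rewrite DL => /eqP; rewrite mulf_eq0 (negbTE c0) subr_eq0 => /eqP.
by [].
Unshelve. all: by end_near. Qed.

End Calculus.

(** * Second fundamental form of a level surface *)

Section SphereGeometry.
Variable R : realType.
Implicit Types (p q : S3 R) (x u v w : 'rV[R]_4) (h : S3 R -> R).

Lemma dot_val p : dot (val p) (val p) = 1.
Proof. exact/eqP/(valP p). Qed.

Lemma enorm_val p : enorm (val p) = 1.
Proof. by rewrite /enorm dot_val sqrtr1. Qed.

Lemma enorm_gt0 x : x != 0 -> 0 < enorm x.
Proof. by move=> x0; rewrite sqrtr_gt0 dot_gt0. Qed.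

Lemma enorm_sqr x : enorm x ^+ 2 = dot x x.
Proof. by rewrite sqr_sqrtr // dot_ge0. Qed.

Lemma enorm_scale (c : R) x : 0 < c -> enorm (c *: x) = c * enorm x.
Proof.
move=> c0; rewrite /enorm dotZl dotZr mulrA -expr2 sqrtrM ?sqr_ge0 //.
by rewrite sqrtr_sqr gtr0_norm.
Qed.

Lemma val_neq0 p : val p != 0.
Proof. by rewrite -dot_eq0 dot_val oner_eq0. Qed.

Lemma ray_ext_val (V : zmodType) (f : S3 R -> V) p : ray_ext f (val p) = f p.
Proof. by rewrite /ray_ext enorm_val invr1 scale1r valK. Qed.

Lemma normalized_point x : x != 0 -> exists2 q : S3 R,
  val q = (enorm x)^-1 *: x & forall (V : zmodType) (f : S3 R -> V), ray_ext f x = f q.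
Proof.
move=> x0; have e0 := enorm_gt0 x0.
have hq : dot ((enorm x)^-1 *: x) ((enorm x)^-1 *: x) == 1.
  by rewrite dotZl dotZr -enorm_sqr; apply/eqP; field; rewrite gt_eqF.
exists (exist (fun y : 'rV[R]_4 => is_true (dot y y == 1)) _ hq) => // V f.
by rewrite /ray_ext insubT /=.
Qed.

Lemma ray_ext_scale (V : zmodType) (f : S3 R -> V) (c : R) x :
  0 < c -> ray_ext f (c *: x) = ray_ext f x.
Proof.
move=> c0; rewrite /ray_ext enorm_scale // scalerA invfM mulrAC mulVf ?gt_eqF //.
by rewrite mul1r.
Qed.

Lemma near_val_neq0 p : \forall x \near val p, x != 0.
Proof. by have /cvgr_neq0 := @cvg_id _ (nbhs (val p)); apply; exact: val_neq0. Qed.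

Lemma sqrt_differentiable (a : R) : 0 < a -> differentiable (@Num.sqrt R) a.
Proof. by move=> /is_derive1_sqrt [h1 _]; apply/derivable1_diffP. Qed.

Lemma differentiable_enorm x : x != 0 -> differentiable (@enorm R) x.
Proof.
move=> x0; apply: (@differentiable_comp _ _ _ _ (fun x => dot x x) Num.sqrt).
  have -> : (fun x : 'rV[R]_4 => dot x x)
            = \sum_(i < 4) ((fun y : 'rV[R]_4 => y 0 i) * (fun y : 'rV[R]_4 => y 0 i)).
    by apply/funext => y; rewrite fct_sumE; apply: eq_bigr.
  by apply: differentiable_sum => i; apply: differentiableM; apply: differentiable_coord.
by apply: sqrt_differentiable; rewrite dot_gt0.
Qed.

Lemma near_normalized p (U : set 'rV[R]_4) : nbhs (val p) U ->
  \forall x \near val p, U ((enorm x)^-1 *: x).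
Proof.
move=> hU.
have c : (enorm x)^-1 *: x @[x --> val p] --> (enorm (val p))^-1 *: val p.
  refine (cvgZ _ cvg_id).
  refine (cvgV _ _); first by rewrite enorm_val oner_neq0.
  exact/differentiable_continuous/differentiable_enorm/val_neq0.
by rewrite enorm_val invr1 scale1r in c; exact: c.
Qed.

Section Gradient.
Variables (h : S3 R -> R).
Let k := ray_ext h.

(** The extension is homogeneous of degree 0, so its gradient has degree -1. *)
Lemma grad_ray_ext_scale (c : R) x : 0 < c -> differentiable k x ->
  grad k (c *: x) = c^-1 *: grad k x.
Proof.
move=> c0 dk; apply/rowP => i; rewrite !mxE /partial.
have e y : y *m (c^-1)%:M = c^-1 *: y by rewrite mul_mx_scalar.
have -> : k = (fun y => k (y *m (c^-1)%:M)).
  by apply/funext => y; rewrite e [in RHS]/k ray_ext_scale // invr_gt0.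
rewrite (derive_mulmx k) !e scalerA mulVf ?gt_eqF // scale1r.
have -> : (fun y => k (y *m (c^-1)%:M)) = k.
  by apply/funext => y; rewrite e [in LHS]/k ray_ext_scale // invr_gt0.
by rewrite !derive_grad // dotZr.
Qed.

Lemma grad_ray_ext_radial p : differentiable k (val p) ->
  dot (grad k (val p)) (val p) = 0.
Proof.
move=> dk; rewrite -derive_grad //; apply: cvg_lim => //=.
apply: (@cvg_trans _ (cst (0 : R) @ 0^')); last exact: cvg_cst.
apply: near_eq_cvg; near=> t => /=.
have -> : t *: val p + val p = (t + 1) *: val p by rewrite scalerDl scale1r.
rewrite [k (_ *: _)]ray_ext_scale ?subrr ?scaler0 //.
suff : `|t| < 1 by rewrite ltr_norml => /andP[]; lra.
by near: t; apply: dnbhs0_lt.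
Unshelve. all: by end_near. Qed.

(** The normalization absorbs the factor by which the gradient changes along
    rays, so near the sphere the extended unit normal is the normalized
    gradient of the extended function. *)
Lemma unit_normal_ray_ext x : x != 0 -> differentiable k x ->
  ray_ext (unit_normal h) x = (enorm (grad k x))^-1 *: grad k x.
Proof.
move=> x0 dk; have [q qx ->] := normalized_point x0.
have e0 := enorm_gt0 x0.
rewrite /unit_normal /sgrad -/k qx grad_ray_ext_scale ?invr_gt0 // invrK.
rewrite enorm_scale // invfM scalerA mulrAC mulVf ?gt_eqF // mul1r.
by [].
Qed.

Lemma dot_unit_normal p : grad k (val p) != 0 ->
  dot (unit_normal h p) (unit_normal h p) = 1.
Proof.
move=> g0; have := enorm_gt0 g0.
rewrite /unit_normal /sgrad -/k dotZl dotZr -enorm_sqr => e0.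
by field; rewrite gt_eqF.
Qed.

(** The derivative of the normalizing factor multiplies the gradient, which is
    orthogonal to [v]. *)
Lemma second_fundamental_formE p v :
  twice_differentiable k (val p) -> grad k (val p) != 0 ->
  dot (grad k (val p)) v = 0 ->
  second_fundamental_form h p v v
  = - ((enorm (grad k (val p)))^-1 * Hess k (val p) v v).
Proof.
move=> [dk ddk] g0 gv; rewrite /second_fundamental_form; congr (- _).
pose g (x : 'rV[R]_4) := (enorm (grad k x))^-1.
have dg : differentiable g (val p).
  apply: differentiableV; last by rewrite gt_eqF ?enorm_gt0.
  apply: (@differentiable_comp _ _ _ _ (fun x => dot (grad k x) (grad k x)) Num.sqrt).
    have -> : (fun x => dot (grad k x) (grad k x))
              = \sum_(i < 4) (partial i k * partial i k).
      by apply/funext => x; rewrite fct_sumE; apply: eq_bigr => i _; rewrite !mxE.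
    by apply: differentiable_sum => i; apply: differentiableM.
  by apply: sqrt_differentiable; rewrite dot_gt0.
rewrite (@near_eq_derive _ _ _ _ (fun x => g x *: grad k x)); last first.
  have nz := near_val_neq0 p.
  near=> x; apply: unit_normal_ray_ext; by near: x.
have dc i j : derivable (fun x => (g x *: grad k x) i j) (val p) v.
  have -> : (fun x => (g x *: grad k x) i j) = g * partial j k.
    by apply/funext => x; rewrite !mxE.
  by apply: derivableM; apply: diff_derivable.
rewrite derive_mx; last by apply/derivable_mxP.
have E j : 'D_v (fun x => (g x *: grad k x) 0 j) (val p) =
   'D_v g (val p) * grad k (val p) 0 j + g (val p) * 'D_v (partial j k) (val p).
  have -> : (fun x => (g x *: grad k x) 0 j) = g * partial j k.
    by apply/funext => x; rewrite !mxE.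
  rewrite deriveM; try exact: diff_derivable.
  have -> : grad k (val p) 0 j = partial j k (val p) by rewrite mxE.
  by rewrite addrC [partial j k _ *: _]mulrC.
rewrite /dot; under eq_bigr do rewrite mxE E mulrDl -!mulrA.
rewrite big_split -!mulr_sumr /= -/(dot _ _) gv mulr0 add0r; congr (_ * _).
rewrite -derive_dot_grad //.
rewrite dot_gradE.
rewrite derive_sum => [|i]; last by apply: derivableZ; apply: diff_derivable.
by apply: eq_bigr => j _; rewrite deriveZ; [exact: mulrC | exact: diff_derivable].
Unshelve. all: by end_near. Qed.

Lemma proj_tangent_orthogonal p v : differentiable k (val p) ->
  grad k (val p) != 0 -> dot (grad k (val p)) (proj_tangent h p v) = 0.
Proof.
move=> dk g0; have e0 := enorm_gt0 g0.
rewrite /proj_tangent /unit_normal /sgrad -/k !dotDr !dotNr !dotZr.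
rewrite grad_ray_ext_radial // mulr0 subr0 -enorm_sqr (dotC v).
by field; rewrite gt_eqF.
Qed.

Lemma unit_normal_radial p : differentiable k (val p) ->
  dot (unit_normal h p) (val p) = 0.
Proof. by move=> dk; rewrite dotZl grad_ray_ext_radial ?mulr0. Qed.

End Gradient.

Lemma Hess_dot f x v w :
  Hess f x v w = dot v (w *m \matrix_(j, i) partial i (partial j f) x).
Proof.
rewrite /Hess /dot; apply: eq_bigr => i _; rewrite mxE mulr_sumr.
by apply: eq_bigr => j _; rewrite mxE; ring.
Qed.

Lemma HessDl f x u v w : Hess f x (u + v) w = Hess f x u w + Hess f x v w.
Proof. by rewrite !Hess_dot dotDl. Qed.

Lemma HessDr f x u v w : Hess f x u (v + w) = Hess f x u v + Hess f x u w.
Proof. by rewrite !Hess_dot mulmxDl dotDr. Qed.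

Lemma HessZl f x (c : R) v w : Hess f x (c *: v) w = c * Hess f x v w.
Proof. by rewrite !Hess_dot dotZl. Qed.

Lemma HessZr f x (c : R) v w : Hess f x v (c *: w) = c * Hess f x v w.
Proof. by rewrite !Hess_dot -scalemxAl dotZr. Qed.

Lemma sum_Hess_l f x u w : \sum_i u 0 i * Hess f x (e_ R i) w = Hess f x u w.
Proof.
rewrite [in RHS]Hess_dot; apply: eq_bigr => i _; congr (_ * _).
by rewrite Hess_dot dotC dot_basis.
Qed.

Lemma sum_Hess_r f x u v : \sum_i u 0 i * Hess f x v (e_ R i) = Hess f x v u.
Proof.
rewrite {2}(row_sum_basis u); under eq_bigr do rewrite -HessZr.
have H0 : Hess f x v 0 = 0 by rewrite -(scale0r 0) HessZr mul0r.
by rewrite (big_morph (Hess f x v) (fun a b => HessDr f x v a b) H0).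
Qed.

Lemma Hess_diag f x i : Hess f x (e_ R i) (e_ R i) = partial i (partial i f) x.
Proof. by rewrite Hess_dot dotC dot_basis -rowE !mxE. Qed.

(** The trace on the orthogonal complement of the unit vectors [u] and [n] is
    the full trace minus the two diagonal terms. *)
Lemma trace_Hess_proj f x u n : dot u u = 1 -> dot n n = 1 -> dot n u = 0 ->
  \sum_i Hess f x (e_ R i - dot (e_ R i) u *: u - dot (e_ R i) n *: n)
                  (e_ R i - dot (e_ R i) u *: u - dot (e_ R i) n *: n)
  = \sum_i partial i (partial i f) x - Hess f x u u - Hess f x n n.
Proof.
move=> uu nn nu.
have expand i : Hess f x (e_ R i - dot (e_ R i) u *: u - dot (e_ R i) n *: n)
                  (e_ R i - dot (e_ R i) u *: u - dot (e_ R i) n *: n) =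
  partial i (partial i f) x - u 0 i * Hess f x (e_ R i) u - u 0 i * Hess f x u (e_ R i)
  - n 0 i * Hess f x (e_ R i) n - n 0 i * Hess f x n (e_ R i)
  + u 0 i * u 0 i * Hess f x u u + n 0 i * n 0 i * Hess f x n n
  + n 0 i * u 0 i * (Hess f x u n + Hess f x n u).
  rewrite !(dotC (e_ R i)) !dot_basis -[- (u 0 i *: u)]scaleNr -[- (n 0 i *: n)]scaleNr.
  rewrite !HessDl !HessDr !HessZl !HessZr Hess_diag.
  ring.
under eq_bigr do rewrite expand.
rewrite !big_split /= !sumrN !sum_Hess_l !sum_Hess_r -!mulr_suml -!/(dot _ _).
rewrite uu nn nu; ring.
Qed.
End SphereGeometry.

(** * Smoothness on open sets *)

Section Smooth.
Variable R : realType.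
Implicit Types (f g : 'rV[R]_4 -> R) (U : set 'rV[R]_4).

(** Both functions have the same first-order expansion at [x]. *)
Lemma near_eq_differentiable f g x : (\forall y \near x, f y = g y) ->
  differentiable f x -> differentiable g x.
Proof.
move=> fg df; have fgx := nbhs_singleton fg.
have E : g \o shift x = cst (g x) + 'd f x +o_ (0 : 'rV[R]_4) id.
  apply/eqaddoP => e e0; have /eqaddoP /(_ e e0) h := diff_locally df.
  have fg0 : \forall u \near nbhs (0 : 'rV[R]_4), f (u + x) = g (u + x).
    by move: fg; rewrite (near_shift 0 x); apply: filterS => u /=; rewrite subr0.
  near=> u.
  have h1 : f (u + x) = g (u + x) by near: u.
  have : `|(f \o shift x - (cst (f x) + 'd f x)) u| <= e * `|id u| by near: u; exact: h.
  by rewrite !fctE /= h1 fgx.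
have D := diff_unique (diff_continuous df) E.
by apply/diff_locallyP; rewrite D; split=> //; exact: diff_continuous.
Unshelve. all: by end_near. Qed.

Lemma near_open U x : open U -> U x -> \forall y \near x, U y.
Proof. by move=> oU Ux; apply: open_nbhs_nbhs. Qed.

(** The partial derivatives at a point of an open set depend only on the values
    of the function on this set. *)
Lemma Ck_on_ext k U f g : open U -> (forall x, U x -> f x = g x) ->
  Ck_on k U f -> Ck_on k U g.
Proof.
move=> oU; elim: k f g => [|k IH] f g fg /=.
  move=> cf x Ux; have n : \forall y \near x, f y = g y.
    by apply: filterS (near_open oU Ux) => y /fg.
  change (g @ x --> g x); rewrite -(fg x Ux); apply: cvg_trans (cf x Ux).
  apply: (@near_eq_cvg _ _ (nbhs x)); near=> y; by near: y.
case=> df ck; split=> [x Ux|i].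
  apply: near_eq_differentiable (df x Ux).
  by apply: filterS (near_open oU Ux) => y /fg.
apply: IH (ck i) => x Ux; apply: near_eq_derive.
by apply: filterS (near_open oU Ux) => y /fg.
Unshelve. all: by end_near. Qed.

Lemma Ck_on_linear k U f g (a b : R) : open U ->
  Ck_on k U f -> Ck_on k U g -> Ck_on k U (a *: f + b *: g).
Proof.
move=> oU; elim: k f g => [|k IH] f g /=.
  move=> cf cg x Ux.
  exact: (cvgD (cvgZ (cvg_cst a) (cf x Ux)) (cvgZ (cvg_cst b) (cg x Ux))).
case=> df ckf [dg ckg]; split=> [x Ux|i].
  by apply: differentiableD; apply: differentiableZ; [exact: df | exact: dg].
apply: (Ck_on_ext oU _ (IH _ _ (ckf i) (ckg i))) => x Ux.
have d1 : derivable f x (e_ R i) by apply/diff_derivable/df.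
have d2 : derivable g x (e_ R i) by apply/diff_derivable/dg.
rewrite /partial deriveD; [|exact: derivableZ|exact: derivableZ].
by rewrite (deriveZ _ d1) (deriveZ _ d2).
Qed.

Lemma twice_differentiable_smooth U f x : open U -> U x -> smooth_on U f ->
  twice_differentiable f x.
Proof.
move=> oU Ux /(_ 2%N) [df /= h]; split.
  by apply: filterS (near_open oU Ux) => y /df.
by move=> i; have [h' _] := h i; apply: h'.
Qed.

End Smooth.

Section Hom.
Variable R : realType.
Implicit Types (G : 'rV[R]_4 -> R) (g : S3 R -> R).

(** Near the sphere [G] is the extension of [g] times the [d]-th power of the
    length; at a zero of [G] the derivative of the second factor does not
    contribute. *)
Lemma grad_homogeneous_restriction (d : nat) G g (p : S3 R) :
  (forall (t : R) x, G (t *: x) = t ^+ d * G x) ->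
  (forall q, g q = G (val q)) ->
  differentiable (ray_ext g) (val p) -> G (val p) = 0 ->
  grad G (val p) = grad (ray_ext g) (val p).
Proof.
move=> hG hg dg G0; apply/rowP => i; rewrite !mxE /partial.
have gp : ray_ext g (val p) = 0 by rewrite ray_ext_val hg.
rewrite (@near_eq_derive _ _ _ _ (ray_ext g * (@enorm R) ^+ d)); last first.
  near=> x; have x0 : x != 0 by near: x; exact: near_val_neq0.
  have [q qx E] := normalized_point x0; have e0 := enorm_gt0 x0.
  rewrite fctE exprfctE E hg qx hG mulrAC -exprMn mulVf ?gt_eqF //.
  by rewrite expr1n mul1r.
have den := differentiable_enorm (val_neq0 p).
rewrite deriveM; [|exact: diff_derivable|exact/derivableX/diff_derivable].
rewrite gp scale0r add0r exprfctE enorm_val expr1n scale1r.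
by [].
Unshelve. all: by end_near. Qed.

End Hom.

(** * Mean curvature of the level surfaces of P *)

Section MeanCurvature.
Variable R : realType.
Local Notation K := R[i].
Variables (F : mpoly 4 K) (d : nat) (f : S3 R -> K).
Hypothesis homF : F \is mpoly.ishomog1 d (@mpoly.mdeg 4).
Hypothesis harmF : \sum_i mderiv i (mderiv i F) = 0.
Hypothesis fF : forall p : S3 R, f p = peval F (val p).
Implicit Types (p q : S3 R) (h : S3 R -> R) (al : K).

Lemma euler_F : \sum_i var i * mderiv i F = (d%:R : R)%:C%:MP * F.
Proof.
have -> : (d%:R : R)%:C = d%:R :> K by rewrite rmorph_nat.
by rewrite (mpoly_euler homF) mpoly.mpolyC_nat.
Qed.

(** Euler's identity, applied twice: the value is [d (d - 1) P x]. *)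
Lemma Hess_P_radial al x : P_ F al x = 0 -> Hess (P_ F al) x x x = 0.
Proof.
move=> P0; rewrite Hess_P exchange_big /=.
transitivity (\sum_(j < 4) x 0 j * ((d%:R - 1) * P_ (mderiv j F) al x)).
  apply: eq_bigr => j _; rewrite -(euler_P al x (euler_mderiv j euler_F)) mulr_sumr.
  by apply: eq_bigr => i _; rewrite mulrC [P_ _ _ _ * _]mulrC.
under eq_bigr do rewrite mulrCA.
by rewrite -mulr_sumr (euler_P al x euler_F) P0 !mulr0.
Qed.

Lemma trace_Hess_P al x : \sum_i partial i (partial i (P_ F al)) x = 0.
Proof.
by under eq_bigr do rewrite !partial_P; rewrite -P_sum harmF P_0.
Qed.

Lemma twice_differentiable_P al x : twice_differentiable (P_ F al) x.
Proof.
split; first by near=> y; exact: differentiable_P.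
by move=> i; rewrite partial_P; exact: differentiable_P.
Unshelve. all: by end_near. Qed.

(** Up to sign, the mean curvature is half the trace, on the tangent plane, of the
    Hessian of [h] divided by the length of its gradient.  This Hessian is [l]
    times that of [P], and the trace of the latter on the complement of [p] and
    the normal [n] is minus its value at [n]. *)
Lemma mean_curvature_eq0 al p h :
  P_ F al (val p) = 0 -> grad (P_ F al) (val p) != 0 ->
  local_defining_function (f @^-1` line al) p h ->
  mean_curvature h p = 0 <->
  Hess (P_ F al) (val p) (grad (P_ F al) (val p)) (grad (P_ F al) (val p)) = 0.
Proof.
move=> Pp g0 [U [oU Up smU zeroU gradU]]; set P := P_ F al in Pp g0 *.
have surf q : (f @^-1` line al) q <-> P (val q) = 0 by rewrite /line /= fF.
set k := ray_ext h in smU.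
have dk := twice_differentiable_smooth oU Up smU.
have dkp := nbhs_singleton dk.1.
have gk0 : grad k (val p) != 0 by apply: gradU => //; apply/surf.
have van : \forall y \near val p, P y = 0 -> k y = 0.
  have n1 := near_normalized (near_open oU Up); have n2 := near_val_neq0 p.
  near=> y => Py; have y0 : y != 0 by near: y.
  have Uy : U ((enorm y)^-1 *: y) by near: y.
  have [q qy E] := normalized_point y0.
  rewrite /k E; apply/zeroU; first by rewrite qy.
  by apply/surf; rewrite qy /P (P_scale _ _ _ homF) -/P Py mulr0.
have [l [gkl HkP]] := level_set_comparison Pp (twice_differentiable_P al _) dk van g0.
have l0 : l != 0 by apply: contraNneq gk0 => l0; rewrite gkl l0 scale0r.
set N := enorm (grad k (val p)); have N0 : N != 0 by rewrite gt_eqF ?enorm_gt0.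
have gP_proj v : dot (grad P (val p)) (proj_tangent h p v) = 0.
  by apply: (mulfI l0); rewrite mulr0 -dotZl -gkl proj_tangent_orthogonal.
have un : unit_normal h p = (N^-1 * l) *: grad P (val p).
  by rewrite -scalerA -gkl.
set Q := Hess P _ _ _.
have -> : mean_curvature h p = 2^-1 * (N^-1 * l * ((N^-1 * l) ^+ 2 * Q)).
  rewrite /mean_curvature; congr (_ * _).
  transitivity (\sum_(i < 4) - (N^-1 * l) *
      Hess P (val p) (proj_tangent h p (e_ R i)) (proj_tangent h p (e_ R i))).
    apply: eq_bigr => i _; rewrite second_fundamental_formE //; last first.
      exact: proj_tangent_orthogonal.
    by rewrite -/k -/N HkP // mulrA mulNr.
  rewrite -mulr_sumr trace_Hess_proj; last first.
  - exact: unit_normal_radial.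
  - exact: dot_unit_normal.
  - exact: dot_val.
  rewrite trace_Hess_P Hess_P_radial // un HessZl HessZr -/Q; ring.
split=> [/eqP|->]; last by rewrite !mulr0.
by rewrite !mulf_eq0 !invr_eq0 (negbTE N0) (negbTE l0) pnatr_eq0 orbF /= => /eqP.
Unshelve. all: by end_near. Qed.

End MeanCurvature.

(** * Regularity and embeddedness *)

Section Regular.
Variable R : realType.
Local Notation K := R[i].
Variables (F : mpoly 4 K) (d : nat) (f : S3 R -> K).
Hypothesis homF : F \is mpoly.ishomog1 d (@mpoly.mdeg 4).
Hypothesis nullF : \sum_i mderiv i F ^+ 2 = 0.
Hypothesis harmF : \sum_i mderiv i (mderiv i F) = 0.
Hypothesis fF : forall p : S3 R, f p = peval F (val p).
Hypothesis smf : csmooth_on [set x : 'rV[R]_4 | x != 0] (ray_ext f).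
Hypothesis f0 : range f 0.
Hypothesis reg : regular_value f 0.
Implicit Types (p q : S3 R) (h : S3 R -> R) (al : K).

(** The differential is onto C at the zeros of [f]. *)
Lemma sdiff_neq0 p : f p = 0 -> exists v, sdiff f p v != 0.
Proof.
by move=> fp; have [v _ E] := reg fp 1; exists v; rewrite E oner_eq0.
Qed.

(** A constant [F] vanishing somewhere is zero, and 0 is then not a regular
    value. *)
Lemma degree_neq0 : (d != 0)%N.
Proof.
have [p _ fp] := f0; have [v] := sdiff_neq0 fp.
apply: contraNneq => d0.
have homF0 : F \is mpoly.ishomog1 0 (@mpoly.mdeg 4) by move: homF; rewrite d0.
have Fc x : peval F x = 0.
  have E y : peval F y = peval F 0.
    transitivity (meval (fun i => 0 * (y 0 i)%:C) F).
      by rewrite (meval_scale _ _ homF0) expr0 mul1r.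
    by apply: mpoly.meval_eq => i; rewrite mul0r mxE.
  by rewrite E -(E (val p)) -fF.
have -> : f = fun=> 0 by apply/funext => q; rewrite fF Fc.
have r0 : ray_ext (fun=> 0 : K) = cst (0 : K) :> ('rV[R]_4 -> K).
  by apply/funext => x; rewrite /ray_ext; case: insub.
rewrite /sdiff /cderiv r0.
have -> : re_part (cst (0 : K)) = cst (0 : R) :> ('rV[R]_4 -> R) by apply/funext.
have -> : im_part (cst (0 : K)) = cst (0 : R) :> ('rV[R]_4 -> R) by apply/funext.
by rewrite !derive_cst.
Qed.

Lemma open_punctured : open [set x : 'rV[R]_4 | x != 0].
Proof.
rewrite openE => x /= x0.
by have /cvgr_neq0 := @cvg_id _ (nbhs x); apply.
Qed.

Lemma ray_ext_Re : ray_ext (fun q => complex.Re (f q)) = re_part (ray_ext f).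
Proof. by apply/funext => x; rewrite /re_part /ray_ext; case: insub. Qed.

Lemma ray_ext_Im : ray_ext (fun q => complex.Im (f q)) = im_part (ray_ext f).
Proof. by apply/funext => x; rewrite /im_part /ray_ext; case: insub. Qed.

Lemma smooth_differentiable (g : 'rV[R]_4 -> R) p :
  smooth_on [set x : 'rV[R]_4 | x != 0] g -> differentiable g (val p).
Proof. by move=> /(_ 1%N) [h _]; apply: h; exact: val_neq0. Qed.

Lemma grad_ray_ext_zero p : f p = 0 ->
  grad (re_part (ray_ext f)) (val p) = grad (re_part (peval F)) (val p) /\
  grad (im_part (ray_ext f)) (val p) = grad (im_part (peval F)) (val p).
Proof.
move=> fp; have [sm1 sm2] := smf; have Fp : peval F (val p) = 0 by rewrite -fF.
split.
- rewrite -ray_ext_Re; symmetry; apply: (@grad_homogeneous_restriction _ d).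
  + by move=> t x; rewrite /re_part (peval_scale _ _ homF) complex_ReM /= mul0r subr0.
  + by move=> q; rewrite fF.
  + by rewrite ray_ext_Re; exact: smooth_differentiable.
  + by rewrite /re_part Fp.
- rewrite -ray_ext_Im; symmetry; apply: (@grad_homogeneous_restriction _ d).
  + by move=> t x; rewrite /im_part (peval_scale _ _ homF) complex_ImM /= mul0r addr0.
  + by move=> q; rewrite fF.
  + by rewrite ray_ext_Im; exact: smooth_differentiable.
  + by rewrite /im_part Fp.
Qed.

(** If the gradient of [F] vanished at [p], Euler's identity would give
    [f p = 0], and the differential of [f] would vanish there although 0 is
    a regular value. *)
Lemma peval_mderiv_neq0 p : exists i, peval (mderiv i F) (val p) != 0.
Proof.
apply: contrapT => /forallNP G0'.
have G0 i : peval (mderiv i F) (val p) = 0.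
  by apply/eqP; apply: contrapT => /negP; exact: G0'.
have fp : f p = 0.
  have dK : (d%:R : K) != 0 by rewrite pnatr_eq0 degree_neq0.
  apply: (mulfI dK); rewrite mulr0 fF.
  have := congr1 (fun G => peval G (val p)) (mpoly_euler homF).
  rewrite /= -(mpoly.mpolyC_nat 4 K d) pevalM pevalC => <-.
  by rewrite peval_sum big1 // => i _; rewrite pevalM G0 mulr0.
have [v /eqP] := sdiff_neq0 fp; apply.
have [sm1 sm2] := smf; have [g1 g2] := grad_ray_ext_zero fp.
rewrite /sdiff /cderiv !derive_grad; try exact: smooth_differentiable.
rewrite g1 g2.
have z1 : grad (re_part (peval F)) (val p) = 0.
  by apply/rowP => i; rewrite !mxE (partial_peval F i _).1 G0.
have z2 : grad (im_part (peval F)) (val p) = 0.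
  by apply/rowP => i; rewrite !mxE (partial_peval F i _).2 G0.
by rewrite z1 z2 /dot big1 // => i _; rewrite mxE mul0r.
Qed.

(** If grad P_alpha vanishes, the conjugate of alpha times the gradient of [F]
    is [i] times a real vector, and a null vector of this form is 0. *)
Lemma grad_P_neq0 al p : `|al| = 1 -> grad (P_ F al) (val p) != 0.
Proof.
move=> al1; apply/eqP => g0.
have [i /eqP] := peval_mderiv_neq0 p; apply.
(* The real parts of these numbers are the partial derivatives of [P]. *)
pose y j := complex.Im (conjc al * peval (mderiv j F) (val p)).
have yE j : conjc al * peval (mderiv j F) (val p) = 'i * (y j)%:C.
  rewrite [LHS]complexE -P_conjE -grad_P g0 mxE.
  by rewrite add0r.
have : \sum_j y j ^+ 2 = 0.
  apply: (@complexI R); rewrite rmorph_sum /=.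
  transitivity (- (\sum_j (conjc al * peval (mderiv j F) (val p)) ^+ 2)).
    rewrite -sumrN; apply: eq_bigr => j _; rewrite yE exprMn sqr_i mulN1r opprK.
    by rewrite rmorphXn.
  under eq_bigr do rewrite exprMn.
  rewrite -mulr_sumr.
  have -> : \sum_j peval (mderiv j F) (val p) ^+ 2 = 0.
    transitivity (peval (\sum_j mderiv j F ^+ 2) (val p)).
      by rewrite peval_sum; apply: eq_bigr => j _; rewrite !expr2 pevalM.
    by rewrite nullF -mpoly.mpolyC0 pevalC.
  by rewrite mulr0 oppr0.
move/eqP; rewrite psumr_eq0 => [/allP/(_ i)|j _]; last exact: sqr_ge0.
rewrite mem_index_enum sqrf_eq0 => /(_ isT)/eqP yi.
have : al * (conjc al * peval (mderiv i F) (val p)) = 0 by rewrite yE yi !mulr0.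
by rewrite mulrA mulrC [al * _]mulrC conjc_mul_norm1 // mulr1.
Qed.

Lemma embedded_level_surface al : `|al| = 1 -> forall p, (f @^-1` line al) p ->
  exists h, local_defining_function (f @^-1` line al) p h.
Proof.
move=> al1 p sp; have [sm1 sm2] := smf.
pose h q := P_ F al (val q).
have hE : ray_ext h = complex.Re al *: re_part (ray_ext f)
                      + complex.Im al *: im_part (ray_ext f).
  apply/funext => x; rewrite -ray_ext_Re -ray_ext_Im !fctE /ray_ext.
  case: insub => [q|] /=; first by rewrite /h /P_ -fF.
  by rewrite !scaler0 addr0.
have smh : smooth_on [set x : 'rV[R]_4 | x != 0] (ray_ext h).
  move=> k; rewrite hE; apply: Ck_on_linear; [exact: open_punctured|exact: sm1|exact: sm2].
exists h, [set x | x != 0]; split => //.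
- exact: open_punctured.
- exact: val_neq0.
- by move=> q _; rewrite /h /line /= fF.
- move=> q _ sq; rewrite /sgrad -(@grad_homogeneous_restriction _ d (P_ F al)) //.
  + exact: grad_P_neq0.
  + by move=> t x; exact: P_scale.
  + exact: smooth_differentiable.
  + by move: sq; rewrite /line /= fF.
Qed.

Lemma minimal_level_surface_iff al : `|al| = 1 ->
  minimal_surface (f @^-1` line al) <->
  forall p : S3 R, P_ F al (val p) = 0 ->
    Hess (P_ F al) (val p) (grad (P_ F al) (val p)) (grad (P_ F al) (val p)) = 0.
Proof.
move=> al1; have surf q : (f @^-1` line al) q <-> P_ F al (val q) = 0.
  by rewrite /line /= fF.
split=> [[emb mc] p Pp|Q0].
  have sp := (surf p).2 Pp; have [h hh] := emb p sp.
  apply/(mean_curvature_eq0 homF harmF fF Pp (grad_P_neq0 p al1) hh).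
  exact: mc hh.
split; first exact: embedded_level_surface.
move=> p h sp hh; have Pp := (surf p).1 sp.
apply/(mean_curvature_eq0 homF harmF fF Pp (grad_P_neq0 p al1) hh).
exact: Q0.
Qed.

End Regular.

(** * The normal term of the mean curvature *)

Section Final.
Variable R : realType.
Local Notation K := R[i].
Implicit Types (F : mpoly 4 K) (al be : K) (x v w : 'rV[R]_4) (P : 'rV[R]_4 -> R).

Lemma grad_mulmx P (M : 'M[R]_4) x : M *m M^T = 1%:M ->
  differentiable P (x *m M) -> differentiable (fun y => P (y *m M)) x ->
  grad P (x *m M) = grad (fun y => P (y *m M)) x *m M.
Proof.
move=> hM dP dPM; have hM' : M^T *m M = 1%:M by apply: mulmx1C.
apply/rowP => i; rewrite -!dot_basis.
have -> : e_ R i = (e_ R i *m M^T) *m M by rewrite -mulmxA hM' mulmx1.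
by rewrite dot_orthogonal // -!derive_grad // (derive_mulmx P).
Qed.

Lemma Hess_mulmx P (M : 'M[R]_4) x v w :
  (forall y, differentiable P y) -> (forall y, differentiable (fun y => P (y *m M)) y) ->
  (forall i, differentiable (partial i P) (x *m M)) ->
  (forall i, differentiable (partial i (fun y => P (y *m M))) x) ->
  Hess (fun y => P (y *m M)) x v w = Hess P (x *m M) (v *m M) (w *m M).
Proof.
move=> dP dPM ddP ddPM; rewrite -!derive_dot_grad //.
rewrite -(derive_mulmx (fun y => dot (grad P y) (w *m M))).
congr ('D_v _ x); apply/funext => y.
by rewrite -!derive_grad // (derive_mulmx P).
Qed.

Lemma mderiv_homog F d i : F \is mpoly.ishomog1 d (@mpoly.mdeg 4) ->
  mderiv i F \is mpoly.ishomog1 d.-1 (@mpoly.mdeg 4).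
Proof.
move=> hF; apply/mpoly.dhomogP => m; rewrite mpoly.mcoeff_msupp mpoly.mcoeff_mderiv.
move=> h; have : mpoly.mcoeff (mpoly.mnm_add m (mpoly.mnm1 i)) F != 0.
  by apply: contraNneq h => ->; rewrite mul0rn.
rewrite -mpoly.mcoeff_msupp => /(mpoly.dhomog_mf hF) /=.
by rewrite mpoly.mdegD mpoly.mdeg1 addn1 => <-.
Qed.

(** The quantity of part (2); up to a nonzero factor it is the mean curvature
    at the points of the surface. *)
Definition normal_curvature P x := Hess P x (grad P x) (grad P x).

Lemma normal_curvature_rotate F (M : 'M[R]_4) al be x : M *m M^T = 1%:M ->
  `|be| = 1 -> (forall y, peval F (y *m M) = be * conjc al * peval F y) ->
  normal_curvature (P_ F al) x = normal_curvature (P_ F be) (x *m M).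
Proof.
move=> hM b1 hF; have E : P_ F al = (fun y => P_ F be (y *m M)).
  by apply/funext => y; rewrite (P_rotate y b1 hF).
have dE y : differentiable (fun y => P_ F be (y *m M)) y.
  by rewrite -E; exact: differentiable_P.
have dP y : differentiable (P_ F be) y by exact: differentiable_P.
have ddP y i : differentiable (partial i (P_ F be)) y.
  by rewrite partial_P; exact: differentiable_P.
have ddE i : differentiable (partial i (fun y => P_ F be (y *m M))) x.
  by rewrite -E partial_P; exact: differentiable_P.
rewrite /normal_curvature (grad_mulmx hM (dP _) (dE _)) E.
exact: (Hess_mulmx _ _ dP dE (ddP _) ddE).
Qed.

Lemma normal_curvature_P F al x : normal_curvature (P_ F al) x =
  \sum_i \sum_j P_ (mderiv i (mderiv j F)) al x
    * P_ (mderiv i F) al x * P_ (mderiv j F) al x.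
Proof.
rewrite /normal_curvature Hess_P; apply: eq_bigr => i _; apply: eq_bigr => j _.
by rewrite !grad_P.
Qed.

(** The terms are products of one second and two first derivatives, which have
    degrees [d - 2], [d - 1] and [d - 1]. *)
Lemma cubic_sum_scale (p p' : mpoly 4 K -> R) (t : R) F d :
  (forall G k, G \is mpoly.ishomog1 k (@mpoly.mdeg 4) -> p' G = t ^+ k * p G) ->
  F \is mpoly.ishomog1 d (@mpoly.mdeg 4) ->
  \sum_i \sum_j p' (mderiv i (mderiv j F)) * p' (mderiv i F) * p' (mderiv j F)
  = t ^+ (d.-2 + d.-1 + d.-1) *
    \sum_i \sum_j p (mderiv i (mderiv j F)) * p (mderiv i F) * p (mderiv j F).
Proof.
move=> hp hF; rewrite mulr_sumr; apply: eq_bigr => i _.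
rewrite [RHS]mulr_sumr; apply: eq_bigr => j _.
have hFi k := mderiv_homog k hF.
rewrite (hp _ _ (mderiv_homog i (hFi j))) (hp _ _ (hFi i)) (hp _ _ (hFi j)).
by rewrite !exprD; ring.
Qed.

Lemma normal_curvature_scale F d al (t : R) x :
  F \is mpoly.ishomog1 d (@mpoly.mdeg 4) ->
  normal_curvature (P_ F al) (t *: x)
  = t ^+ (d.-2 + d.-1 + d.-1) * normal_curvature (P_ F al) x.
Proof.
move=> hF; apply: etrans (normal_curvature_P _ _ _) _.
apply: etrans _ (esym (congr1 _ (normal_curvature_P _ _ _))).
have hp G k (hG : G \is mpoly.ishomog1 k (@mpoly.mdeg 4)) := P_scale al t x hG.
exact: (cubic_sum_scale hp hF).
Qed.

(** Euler's identity for the first and second derivatives, evaluated at 0: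
    the gradient vanishes there unless [d = 1], and the Hessian vanishes unless
    [d = 2]. *)
Lemma normal_curvature_origin F d al : F \is mpoly.ishomog1 d (@mpoly.mdeg 4) ->
  normal_curvature (P_ F al) 0 = 0.
Proof.
move=> hF; have eulF := euler_F hF.
have g0 i : (d%:R - 1) * P_ (mderiv i F) al 0 = 0.
  rewrite -(euler_P al 0 (euler_mderiv i eulF)) big1 // => j _.
  by rewrite mxE mul0r.
have H0 i j : (d%:R - 1 - 1) * P_ (mderiv i (mderiv j F)) al 0 = 0.
  rewrite -(euler_P al 0 (euler_mderiv i (euler_mderiv j eulF))) big1 // => k _.
  by rewrite mxE mul0r.
rewrite normal_curvature_P big1 // => i _; apply: big1 => j _.
have /eqP := g0 i; rewrite mulf_eq0 => /orP[/eqP d1|/eqP ->].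
  have /eqP := H0 i j; rewrite d1 sub0r mulf_eq0 oppr_eq0 oner_eq0 => /eqP ->.
  by rewrite !mul0r.
by rewrite mulr0 mul0r.
Qed.

(** The condition of part (2) concerns all of R^4, minimality only the
    sphere; homogeneity relates the two away from the origin. *)
Lemma normal_curvature_sphere F d al : F \is mpoly.ishomog1 d (@mpoly.mdeg 4) ->
  (forall p : S3 R, P_ F al (val p) = 0 -> normal_curvature (P_ F al) (val p) = 0) ->
  forall x, P_ F al x = 0 -> normal_curvature (P_ F al) x = 0.
Proof.
move=> hF hS x Px; have [->|x0] := eqVneq x 0; first exact: normal_curvature_origin hF.
have [q qx _] := normalized_point x0; have e0 := enorm_gt0 x0.
have xq : x = enorm x *: val q by rewrite qx scalerA divff ?gt_eqF // scale1r.
have E := normal_curvature_scale al (enorm x) (val q) hF.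
rewrite -xq in E; apply: etrans E _.
have Pq : P_ F al (val q) = 0 by rewrite qx (P_scale _ _ _ hF) Px mulr0.
by rewrite (hS q Pq) mulr0.
Qed.

End Final.

Unset Implicit Arguments.

Theorem theorem1p5 (R : realType) (lambda mu : R[i]) (f : S3 R -> R[i])
    (F : mpoly.mpoly 4 R[i])
    (hf : eigenfunction_S3 lambda mu f)
    (hF : given_by f F)
    (h0 : range f 0)
    (hreg : regular_value f 0) :
  (forall alpha beta : R[i], `|alpha| = 1 -> `|beta| = 1 ->
     exists Phi : 'rV[R]_4 -> 'rV[R]_4,
       isometry_between setT setT Phi /\
       isometry_between (val @` (f @^-1` line alpha))
                        (val @` (f @^-1` line beta)) Phi)
  /\
  ((forall alpha : R[i], `|alpha| = 1 -> minimal_surface (f @^-1` line alpha))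
   <->
   (exists alpha0 : R[i], `|alpha0| = 1 /\
      forall x : 'rV[R]_4, P_ F alpha0 x = 0 ->
        Hess (P_ F alpha0) x (grad (P_ F alpha0) x) (grad (P_ F alpha0) x) = 0)).
Proof.
have [smf _ _] := hf; have [[d homF] eigF fF] := hF.
have [nullF harmF] := eigenfunction_E4_poly eigF.
have d0 := degree_neq0 homF fF h0 hreg.
have rot al be : `|al| = 1 -> `|be| = 1 -> exists M : 'M[R]_4,
    M *m M^T = 1%:M /\ forall y, peval F (y *m M) = be * conjc al * peval F y.
  move=> a1 b1; apply: (peval_equivariance homF d0 nullF harmF).
  by rewrite normrM norm_conjc a1 b1 mulr1.
split.
  move=> al be a1 b1; have [M [hM hFM]] := rot al be a1 b1.
  by exists (fun x => x *m M); exact: surface_isometry fF b1 hM hFM.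
have crit al := @minimal_level_surface_iff R F d f homF nullF harmF fF smf h0 hreg al.
split=> [hmin|[al0 [a1 H0]] al b1].
  exists 1; split; first exact: normr1.
  apply: (normal_curvature_sphere homF).
  by apply/crit; [exact: normr1 | apply: hmin; exact: normr1].
apply/crit => // p Pp; have [M [hM hFM]] := rot al al0 b1 a1.
have := normal_curvature_rotate (val p) hM a1 hFM; rewrite /normal_curvature => ->.
by apply: H0; rewrite (P_rotate _ a1 hFM).
Qed.
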